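(* Let $V=\mathbb{R}^{1,n+1}$ be the $(n+2)$-dimensional Minkowski vector space. Every totally reducible subalgebra $\mathfrak{h}$ of the Lorentz algebra $\mathfrak{so}(V)$ is conjugate to a subalgebra of one of the following types (with respect to a standard decomposition $V=\mathbb{R}p+E+\mathbb{R}q$): Type I: a subalgebra of the maximal compact Lie algebra $\mathfrak{so}(n+1)$; Type II: a subalgebra of the form $\mathfrak{so}(W)+\mathfrak{k}$, where $W=V(H)$ is a Lorentzian subspace of $V$ with $\dim W\ge 3$, and $\mathfrak{k}$ is a compact subalgebra of $\mathfrak{so}(W^{\perp})$; Type III: a subalgebra of the form $\mathbb{R}d\oplus\mathfrak{k}$, where $d=p\wedge q+C_0$ with $C_0\in\mathfrak{so}(E)=\mathfrak{so}(n)$ (possibly $C_0=0$), and $\mathfrak{k}$ is a subalgebra of the centralizer $C_{\mathfrak{so}(n)}(C_0)$.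
   Context: $V=\mathbb{R}^{1,n+1}$ is equipped with the Lorentzian inner product $g(u,v)=-u_0v_0+\sum_{i=1}^{n+1}u_iv_i$. Fix a Witt basis $p,e_1,\dots,e_n,q$ of $V$: $p,q$ are isotropic with $g(p,q)=1$, and $e_1,\dots,e_n$ is an orthonormal basis of $E:=(\mathbb{R}p+\mathbb{R}q)^{\perp}$, a Euclidean space. The decomposition $V=\mathbb{R}p+E+\mathbb{R}q$ is called a standard decomposition. Skew-symmetric endomorphisms are identified with bivectors, $\mathfrak{so}(V)\cong\Lambda^2V$. For a subspace $H\subset E$, $V(H):=\mathbb{R}p+H+\mathbb{R}q$. A subalgebra of $\mathfrak{so}(V)$ is totally reducible if every invariant subspace of $V$ has an invariant complement. Conjugacy is under the Lorentz group. *)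

(* Defs.v *)
From HB Require Import structures.
From mathcomp Require Import all_boot all_order all_algebra.
From mathcomp Require Import reals.

Set Implicit Arguments.
Unset Strict Implicit.
Unset Printing Implicit Defensive.

Import GRing.Theory Num.Theory.
Local Open Scope ring_scope.

(* Vectors of V = R^{1,n+1} are columns of length n.+2, with the time coordinate
   at index ord0; endomorphisms are matrices acting on columns from the left. *)

Section Minkowski.
Variables (R : realType) (n : nat).
Local Notation V := 'cV[R]_n.+2.
Local Notation gl := 'M[R]_n.+2.

Definition minkowski (u v : V) : R :=
  - (u ord0 0 * v ord0 0)
  + \sum_(i < n.+1) u (lift ord0 i) 0 * v (lift ord0 i) 0.

Lemma minkowski_sym (u v : V) :
  minkowski u v = (-1) ^+ false * idfun (minkowski v u).
Proof.
rewrite /minkowski expr0 mul1r /= mulrC; congr (_ + _).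
by apply: eq_bigr => i _; rewrite mulrC.
Qed.

Lemma minkowski_linear (u : V) : GRing.linear_for *%R (minkowski u).
Proof.
move=> a v w; rewrite /minkowski !mxE mulrDr (mulrDr a) mulr_sumr.
rewrite opprD mulrN mulrCA -!addrA; congr (_ + _).
rewrite [RHS]addrCA; congr (_ + _); rewrite -big_split /=.
by apply: eq_bigr => i _; rewrite !mxE mulrDr mulrCA.
Qed.

Lemma minkowski_bilinear : bilinear_for
  (GRing.Scale.Law.clone _ _ *%R _)
  (GRing.Scale.Law.clone _ _ (idfun \; *%R) _) minkowski.
Proof.
split=> [v|u] a x y /=; last exact: minkowski_linear.
rewrite minkowski_sym expr0 mul1r /= minkowski_linear.
by congr (_ * _ + _); rewrite minkowski_sym expr0 mul1r.
Qed.

HB.instance Definition _ :=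
  bilinear_isBilinear.Build R V V R _ _ minkowski minkowski_bilinear.
HB.instance Definition _ :=
  isHermitianSesquilinear.Build R V false idfun minkowski minkowski_sym.

Definition perp (U : {vspace V}) : {vspace V} := orthov minkowski U.

Definition lorentz_group (T : gl) : Prop :=
  isometry minkowski minkowski (mulmx T).

Definition bracket (A B : gl) : gl := A *m B - B *m A.

Definition eta : gl := diag_mx (\row_i if i == ord0 then -1 else 1).

Definition skew_defect (A : gl) : gl := A^T *m eta + eta *m A.

Lemma skew_defect_linear : linear skew_defect.
Proof.
move=> a A B; rewrite /skew_defect linearP /= mulmxDl mulmxDr scalerDr.
by rewrite -scalemxAl -scalemxAr addrACA.
Qed.
HB.instance Definition _ :=
  GRing.isLinear.Build R gl gl *:%R skew_defect skew_defect_linear.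

(* For a nondegenerate subspace U, [so U] is so(U) = Lambda^2 U embedded in
   so(V) = Lambda^2 V: the skew-symmetric endomorphisms of V vanishing on the
   orthogonal complement of U.  See [mem_soP]. *)
Definition so (U : {vspace V}) : {vspace gl} :=
  (lker (linfun skew_defect) :&:
   \bigcap_(i < \dim (perp U)) lker (linfun (mulmxr (vbasis (perp U))`_i)))%VS.

Lemma minkowskiE (u v : V) : minkowski u v = (u^T *m eta *m v) 0 0.
Proof.
rewrite /minkowski /eta mul_mx_diag [RHS]mxE [RHS]big_ord_recl !mxE /= mulrN1 mulNr.
by congr (_ + _); apply: eq_bigr => i _; rewrite !mxE /= mulr1.
Qed.

Lemma mem_soP (U : {vspace V}) (A : gl) :
  reflect ((forall u v, minkowski (A *m u) v + minkowski u (A *m v) = 0) /\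
           {in perp U, forall w, A *m w = 0})
          (A \in so U).
Proof.
have defectE u v : minkowski (A *m u) v + minkowski u (A *m v) =
    (u^T *m skew_defect A *m v) 0 0.
  rewrite !minkowskiE /skew_defect trmx_mul mulmxDr mulmxDl !mulmxA.
  by rewrite [RHS]mxE.
apply: (iffP idP) => [|[skA A0]].
  rewrite /so memv_cap memv_ker lfunE /= => /andP[/eqP skA /subv_bigcapP kA].
  split=> [u v|w wU]; first by rewrite defectE skA mulmx0 mul0mx mxE.
  rewrite (coord_vbasis wU) mulmx_sumr big1 // => i _.
  have := kA i isT; rewrite -memvE memv_ker lfunE /= => /eqP Ai0.
  by rewrite -scalemxAr Ai0 scaler0.
rewrite /so memv_cap memv_ker lfunE; apply/andP; split.
  apply/eqP/matrixP => i j; rewrite [RHS]mxE -(skA (delta_mx i 0) (delta_mx j 0)).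
  by rewrite defectE trmx_delta -mulmxA -colE -rowE !mxE.
rewrite memvE; apply/subv_bigcapP => i _.
rewrite -memvE memv_ker lfunE /= A0 //.
by apply: vbasis_mem; rewrite mem_nth // size_tuple.
Qed.

Definition lie_subalgebra (L k : {vspace gl}) : Prop :=
  (k <= L)%VS /\ {in k &, forall A B, bracket A B \in k}.

Lemma bracket_linear (A : gl) : linear (bracket A).
Proof.
move=> a B C; rewrite /bracket linearP /= mulmxDl -scalemxAl scalerBr.
by rewrite opprD addrACA.
Qed.
HB.instance Definition _ (A : gl) :=
  GRing.isLinear.Build R gl gl *:%R (bracket A) (bracket_linear A).

Definition lie_centralizer (L : {vspace gl}) (C : gl) : {vspace gl} :=
  (L :&: lker (linfun (bracket C)))%VS.

(* A compact Lie algebra is one carrying an ad-invariant inner product. *)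
Definition compact_lie (k : {vspace gl}) : Prop :=
  exists b : {symmetric gl},
    {in k, forall A, A != 0 -> 0 < b A A} /\
    {in k & &, forall A B C, b (bracket A B) C + b B (bracket A C) = 0}.

Definition invariant (h : {vspace gl}) (U : {vspace V}) : Prop :=
  {in h & U, forall A u, A *m u \in U}.

Definition totally_reducible (h : {vspace gl}) : Prop :=
  forall U : {vspace V}, invariant h U ->
  exists U' : {vspace V},
    [/\ invariant h U', (U + U')%VS = fullv & (U :&: U')%VS = 0%VS].

Definition conj_lie (T : gl) (h : {vspace gl}) : {vspace gl} :=
  (linfun (mulmxr (invmx T) \o mulmx T) @: h)%VS.

Lemma mem_conj_lie (T A : gl) (h : {vspace gl}) :
  reflect (exists2 B, B \in h & A = T *m B *m invmx T) (A \in conj_lie T h).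
Proof.
apply: (iffP memv_imgP) => -[B hB ->]; exists B => //; by rewrite lfunE.
Qed.

(* Sign convention: (u /\ v) w = g(u,w) v - g(v,w) u. *)
Definition wedge (u v : V) : gl := v *m u^T *m eta - u *m v^T *m eta.

Lemma wedgeE (u v w : V) :
  wedge u v *m w = minkowski u w *: v - minkowski v w *: u.
Proof.
have sc (x : V) (M : 'M[R]_1) : x *m M = M 0 0 *: x.
  by rewrite [M in LHS]mx11_scalar mul_mx_scalar.
by rewrite /wedge mulmxBl -!mulmxA !sc !mulmxA -!minkowskiE.
Qed.

Definition eucl (p q : V) : {vspace V} := perp (<[p]> + <[q]>)%VS.

Definition witt_basis (p : V) (e : n.-tuple V) (q : V) : Prop :=
  [/\ [/\ minkowski p p = 0, minkowski q q = 0 & minkowski p q = 1],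
      basis_of (eucl p q) e, orthonormal minkowski e
    & basis_of fullv (p :: rcons e q)].

(* Signature (1, dim W - 1): a negative vector of W whose orthogonal
   complement in W is positive definite. *)
Definition lorentzian (W : {vspace V}) : Prop :=
  exists2 t, t \in W & minkowski t t < 0 /\
    {in W, forall w, minkowski t w = 0 -> w != 0 -> 0 < minkowski w w}.

Definition time_axis : V := delta_mx ord0 0.

(* so(n+1) is the block of so(1,n+1) killing the time axis. *)
Definition typeI (h : {vspace gl}) : Prop :=
  lie_subalgebra (so (perp <[time_axis]>%VS)) h.

Definition typeII (p q : V) (h : {vspace gl}) : Prop :=
  exists H : {vspace V}, (H <= eucl p q)%VS /\
  let W := (<[p]> + H + <[q]>)%VS in
  [/\ lorentzian W, (3 <= \dim W)%N &
      exists k : {vspace gl},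
        [/\ lie_subalgebra (so (perp W)) k, compact_lie k
          & h = (so W + k)%VS]].

Definition typeIII (p q : V) (h : {vspace gl}) : Prop :=
  exists (C0 : gl) (k : {vspace gl}), let d := wedge p q + C0 in
  [/\ C0 \in so (eucl p q),
      lie_subalgebra (lie_centralizer (so (eucl p q)) C0) k,
      (<[d]> :&: k)%VS = 0%VS
    & h = (<[d]> + k)%VS].

End Minkowski.

(* Main.v *)
From HB Require Import structures.
Require Import Defs.
From mathcomp Require Import all_boot all_order all_algebra.
From mathcomp Require Import ring lra.
From mathcomp Require Import boolp classical_sets reals topology normedtype derive.

Set Implicit Arguments.
Unset Strict Implicit.
Unset Printing Implicit Defensive.

Import Order.TTheory GRing.Theory Num.Theory.
Import numFieldNormedType.Exports.
Local Open Scope ring_scope.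

(** A totally reducible algebra [h] of skew endomorphisms of Minkowski space
falls under one of the three types according to whether some [X] in [h] is
hyperbolic, that is, has a nonzero real eigenvalue.

Without hyperbolic elements, [h] fixes a causal vector ([fixes_causal]).  The
tool is a variational principle ([skewadj_family_eigen]): for skew
endomorphisms [A_1, ..., A_k], the minimum over timelike [v] of the quotient of
[\sum_i g (A_i v) (A_i v)] by [- g v v] is reached either at a timelike
eigenvector of [\sum_i A_i ^ 2] with eigenvalue [mu >= 0], or in the limit at a
null vector which is an eigenvector of every [A_i].  For a single non-hyperbolic
[X] it gives a causal vector killed by [X], whence [\tr (X ^ 2) <= 0], with
equality only if [X = 0] or [X] is a null bivector [p /\ a]
([tr_sqr_nonhyperbolic]).  If [h] contains a null bivector [p /\ a], then two
brackets with an element moving the line of [p] would produce a hyperbolic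
element, so [h] kills [p] ([nilpotent_fixes]).  Otherwise [- \tr (X Y)] is an
invariant inner product on [h], and the principle applies to an orthonormal
basis: [\sum_i A_i ^ 2] is then the Casimir operator, which commutes with [h].
If its eigenvalue [mu] were positive, the eigenspace [U] would be Lorentzian and
invariant, and the traces of the squares of the [A_i] restricted to [U] would
add up to [mu * \dim U > 0], although each of them is nonpositive.  So
[mu = 0], and [v] is killed by [h]; so is a null [v], its eigenvalues being
zero.  Total reducibility replaces a fixed null
vector by a fixed timelike one ([fixes_timelike]): type I.

If [h] contains a hyperbolic element, a Lorentz transformation and a rescaling
turn it into [d] with [d p = - p] and [d q = q], so that [d = p /\ q + C] with
[C] in [so E].  With respect to the positive definite form
[- \tr (X theta Y)], where [theta] is the Cartan involution exchanging [p] and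
[q], [ad d] is a normal operator; an invariant subspace of a normal operator is
invariant under the adjoint ([normal_stable]), so [h] is stable under
[ad (p /\ q)] ([boost_stable]), hence graded by its weights.  The weight spaces
of [h] for the weights -1 and 1 are [p /\ N] and [q /\ M], for subspaces [N],
[M] of [E].  If both are nonzero, brackets show [N = M] ([weight_transfer]); then [h] contains [so W] and
preserves [W = R p + N + R q], and is of type II ([typeII_of_weights]).
If one of them vanishes, [h] preserves one of the lines [R p], [R q], hence both
by total reducibility ([opposite_line]); choosing [d] orthogonal to
[k = h :&: so E] for the trace form makes it commute with [k], and [h] is of
type III ([typeIII_of_lines]). *)

(** * Minima of quadratic forms on the causal cone *)
Section CausalMinimum.
Local Open Scope classical_set_scope.
Variables (R : realType) (n : nat).
Local Notation V := 'cV[R]_n.+2.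
Local Notation gl := 'M[R]_n.+2.
Local Notation g := (@minkowski R n).

(** The quadratic form with Gram matrix [M]. *)
Definition quad (M : gl) (v : V) : R := (v^T *m M *m v) 0 0.

Lemma quadD (M N : gl) v : quad (M + N) v = quad M v + quad N v.
Proof. by rewrite /quad mulmxDr mulmxDl mxE. Qed.

Lemma quadZ a (M : gl) v : quad (a *: M) v = a * quad M v.
Proof. by rewrite /quad -scalemxAr -scalemxAl mxE. Qed.

Lemma quadZr a (M : gl) v : quad M (a *: v) = a ^+ 2 * quad M v.
Proof.
by rewrite /quad -scalemxAr [_^T]linearZ -!scalemxAl !mxE mulrA expr2.
Qed.

Lemma quad_eta v : quad (eta R n) v = g v v.
Proof. by rewrite /quad minkowskiE. Qed.

Lemma quad_continuous (M : gl) : continuous (fun x : 'rV[R]_n.+2 => quad M x^T).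
Proof.
rewrite /quad.
have -> : (fun x : 'rV[R]_n.+2 => (x^T^T *m M *m x^T) 0 0) =
    (fun x => \sum_j (\sum_i x 0 i * M i j) * x 0 j).
  apply/funext => y; rewrite mxE; apply: eq_bigr => j _.
  by rewrite !mxE; congr (_ * _); apply: eq_bigr => i _; rewrite trmxK.
have addc : continuous (fun z : R * R => z.1 + z.2).
  by move=> z; apply: cvgD; [exact: cvg_fst | exact: cvg_snd].
have colc j : continuous (fun x : 'rV[R]_n.+2 => \sum_i x 0 i * M i j).
  apply: continuous_big => [|i _ x]; first exact: addc.
  by apply: continuousM; [exact: coord_continuous | exact: cst_continuous].
apply: continuous_big => [|j _ x]; first exact: addc.
by apply: continuousM; [exact: colc | exact: coord_continuous].
Qed.

(** The causal vectors with time coordinate 1 form a compact set, a closed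
Euclidean ball. *)
Lemma quad_min_causal (M : gl) : exists v : V, [/\ v 0 0 = 1, g v v <= 0 &
  forall u : V, u 0 0 = 1 -> g u u <= 0 -> quad M v <= quad M u].
Proof.
pose K := [set x : 'rV[R]_n.+2 | x 0 0 = 1 /\ g x^T x^T <= 0].
have clK : closed K.
  have -> : K = (fun x : 'rV[R]_n.+2 => x 0 0) @^-1` [set 1] `&`
      (fun x : 'rV[R]_n.+2 => quad (eta R n) x^T) @^-1` [set y | y <= 0].
    by apply/seteqP; split=> x /=; rewrite quad_eta.
  apply: closedI; apply: preimage_closed.
  - by move=> x _; exact: coord_continuous.
  - exact: closed_eq.
  - by move=> x _; exact: quad_continuous.
  - exact: closed_le.
have cK : compact K.
  have c1 : compact [set x : 'rV[R]_n.+2 | forall i, x ord0 i \in `[(-1), 1]%R].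
    have := @rV_compact R n.+2 (fun=> `[(-1), 1]%classic).
    by apply=> _; apply: segment_compact.
  apply: subclosed_compact clK c1 _ => x [x0 gx] i /=.
  rewrite in_itv /= -ler_norml -[1]normr1 -ler_sqr ?nnegrE ?normr_ge0//.
  rewrite !real_normK ?num_real// expr1n.
  case: (unliftP ord0 i) => [j ->|->]; last by rewrite x0 expr1n.
  move: gx; rewrite /minkowski !mxE x0 mulr1 addrC subr_le0.
  apply: le_trans; rewrite (bigD1 j)//= !mxE -expr2 lerDl.
  by apply: sumr_ge0 => k _; rewrite !mxE -expr2 sqr_ge0.
have K0 : K !=set0.
  exists (delta_mx 0 0); split; first by rewrite mxE.
  rewrite /minkowski !mxE /= big1 ?addr0 ?mulr1 ?lerN10// => i _.
  by rewrite !mxE mul0r.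
have [x] := EVT_min_rV (f := fun x => quad M x^T) K0 cK
   (continuous_subspaceT (@quad_continuous M)).
rewrite inE => -[x0 gx] xmin; exists x^T; split=> //.
  by rewrite mxE.
move=> u u0 gu; have := xmin u^T; rewrite inE trmxK; apply.
by split; rewrite ?mxE ?trmxK.
Qed.

Lemma minkowski_slice_ge (u : V) : u 0 0 = 1 -> -1 <= g u u.
Proof.
move=> u0; rewrite /minkowski u0 mulr1 lerDl.
by apply: sumr_ge0 => k _; rewrite -expr2 sqr_ge0.
Qed.

Lemma causal_time_neq0 (u : V) : u != 0 -> g u u <= 0 -> u 0 0 != 0.
Proof.
move=> un0 gu; apply: contraNneq un0 => u0; apply/eqP/colP => i.
rewrite mxE; case: (unliftP ord0 i) => [j ->|->]; last by [].
move: gu; rewrite /minkowski u0 mulr0 oppr0 add0r => gu.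
have /eqP : \sum_(i < n.+1) u (lift ord0 i) 0 * u (lift ord0 i) 0 = 0.
  by apply/eqP; rewrite eq_le gu sumr_ge0// => k _; rewrite -expr2 sqr_ge0.
rewrite psumr_eq0 => [/allP/(_ j)|k _]; last by rewrite -expr2 sqr_ge0.
by rewrite mem_index_enum mulf_eq0 orbb => /(_ isT)/eqP.
Qed.

(** [mu] is the largest number for which [quad M + mu * g] is nonnegative on the
causal cone; by compactness it vanishes at some causal [v]. *)
Lemma causal_pencil (M : gl) : (forall v : V, g v v <= 0 -> 0 <= quad M v) ->
  exists (v : V) (mu : R), [/\ v != 0, g v v <= 0, 0 <= mu,
    quad M v + mu * g v v = 0 &
    forall u : V, g u u <= 0 -> 0 <= quad M u + mu * g u u].
Proof.
move=> M0.
pose S := [set mu : R | 0 <= mu /\ forall u : V, u 0 0 = 1 -> g u u <= 0 ->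
  0 <= quad M u + mu * g u u].
pose e0 : V := delta_mx 0 0.
have e00 : e0 0 0 = 1 by rewrite mxE.
have ge0 : g e0 e0 = -1.
  rewrite /minkowski e00 mulr1 big1 ?addr0// => i _.
  by rewrite !mxE mul0r.
have S0 : S 0 by split=> // u _ /M0; rewrite mul0r addr0.
have ubS : ubound S (quad M e0).
  by move=> mu [_ /(_ e0 e00)]; rewrite ge0 => /(_ (lerN10 _)); lra.
have hS : has_sup S by split; [exists 0 | exists (quad M e0)].
pose mu := sup S.
have mu0 : 0 <= mu by exact: sup_upper_bound.
have Smu : S mu.
  split=> // u u0 gu; rewrite leNgt; apply/negP => lt0.
  (* A null [u] causes no failure; a timelike one bounds every element of [S],
     hence [mu], by [quad M u / - g u u]. *)
  have gu0 : g u u < 0.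
    rewrite lt_neqAle gu andbT; apply: contraTneq lt0 => gu0.
    by rewrite gu0 mulr0 addr0 -leNgt M0// gu0.
  have : mu <= quad M u / - g u u.
    apply: ge_sup; first by exists 0.
    move=> x [_ /(_ _ u0 gu)]; rewrite ler_pdivlMr; nra.
  rewrite ler_pdivlMr ?oppr_gt0//; nra.
have [v [v0 gv vmin]] := quad_min_causal (M + mu *: eta R n).
have {}vmin (u : V) : u 0 0 = 1 -> g u u <= 0 ->
    quad M v + mu * g v v <= quad M u + mu * g u u.
  by move=> u0 gu; have := vmin _ u0 gu; rewrite !quadD !quadZ !quad_eta.
exists v, mu; split=> //.
- apply: contraTneq isT => vv; move: v0; rewrite vv mxE => /eqP.
  by rewrite eq_sym oner_eq0.
- apply/eqP; rewrite eq_le (proj2 Smu)// andbT leNgt; apply/negP => m0.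
  set m := quad M v + _ in vmin m0.
  (* Were the minimum [m] positive, [mu + m] would still be in [S], because
     [g] is at least -1 on the slice. *)
  have : S (mu + m).
    split=> [|u u0 gu]; first by rewrite addr_ge0// ltW.
    have := vmin _ u0 gu; have := minkowski_slice_ge u0; nra.
  by move=> /(sup_upper_bound hS); rewrite -/mu gerDl leNgt m0.
- move=> u gu; have [->|un0] := eqVneq u 0.
    by rewrite -quad_eta /quad !mulmx0 mxE mulr0 addr0.
  have u0 := causal_time_neq0 un0 gu.
  have uE : u = u 0 0 *: ((u 0 0)^-1 *: u) by rewrite scalerA divff// scale1r.
  set w := _ *: u in uE; have w0 : w 0 0 = 1 by rewrite mxE mulVf.
  have guw : g u u = u 0 0 ^+ 2 * g w w by rewrite [in LHS]uE -!quad_eta quadZr.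
  have p2 : 0 < u 0 0 ^+ 2 by rewrite exprn_even_gt0.
  have gw : g w w <= 0 by rewrite -(pmulr_rle0 _ p2) -guw.
  rewrite guw [in quad M u]uE quadZr mulrCA -mulrDr pmulr_rge0//.
  exact: (proj2 Smu).
Qed.
End CausalMinimum.

(** * Gram-Schmidt and normal operators *)
Section GramSchmidt.
Variables (R : rcfType) (L : vectType R) (b : L -> L -> R).
Hypothesis b_sym : forall x y, b x y = b y x.
Hypothesis b_lin : forall x, GRing.linear_for *%R (b x).

HB.instance Definition _ x := GRing.isLinear.Build R L R *%R (b x) (b_lin x).

(** An orthonormal family [f] of [U] with respect to which every vector of [U]
has its Fourier expansion. *)
Lemma gram_schmidt (U : {vspace L}) :
    {in U, forall x, x != 0 -> 0 < b x x} ->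
  exists k (f : 'I_k -> L), [/\ forall i, f i \in U,
    forall i j, b (f i) (f j) = (i == j)%:R &
    {in U, forall x, x = \sum_i b (f i) x *: f i}].
Proof.
have [m] := ubnP (\dim U); elim: m U => // m IHm U dimU Upos.
have [U0|Un0] := eqVneq U 0%VS.
  exists 0%N, (fun=> 0); split=> [[]|[]|x] //.
  by rewrite U0 memv0 big_ord0 => /eqP.
pose x := vpick U; have xU : x \in U by exact: memv_pick.
have xn0 : x != 0 by rewrite vpick0.
have bx := Upos _ xU xn0.
pose e := (Num.sqrt (b x x))^-1 *: x.
have sn0 : Num.sqrt (b x x) != 0 by rewrite sqrtr_eq0 -ltNge.
have be : b e e = 1.
  rewrite /e linearZ /= b_sym linearZ /= mulrA -invfM -expr2 sqr_sqrtr ?ltW//.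
  by rewrite mulVf// gt_eqF.
have eU : e \in U by rewrite memvZ.
pose U' := (U :&: lker (linfun (b e : L -> R^o)))%VS.
have memU' y : (y \in U') = (y \in U) && (b e y == 0).
  by rewrite memv_cap memv_ker lfunE.
have [||k [f [fU fo fb]]] := IHm U'.
- rewrite -ltnS (leq_trans _ dimU)// ltnS ltn_neqAle dimvS ?capvSl// andbT.
  apply: contraTneq isT => dimE.
  have /eqP UU' : U' == U by rewrite eqEdim capvSl dimE /=.
  by move: eU; rewrite -UU' memU' be oner_eq0 andbF.
- by move=> y; rewrite memU' => /andP[+ _]; exact: Upos.
exists k.+1, (fun i => if unlift ord0 i is Some j then f j else e).
split=> [i|i j|y yU].
- by case: unliftP => [j _|_]//; have := fU j; rewrite memU' => /andP[].
- have fe l : b e (f l) = 0 by have := fU l; rewrite memU' => /andP[_ /eqP].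
  case: (unliftP ord0 i) => [i'|] ->; case: (unliftP ord0 j) => [j'|] ->.
  + by rewrite ?liftK ?unlift_none fo (inj_eq lift_inj).
  + by rewrite ?liftK ?unlift_none b_sym fe.
  + by rewrite ?liftK ?unlift_none fe.
  + by rewrite ?unlift_none be eqxx.
rewrite big_ord_recl unlift_none.
have yU' : y - b e y *: e \in U'.
  by rewrite memU' memvB ?memvZ//= linearB linearZ /= be mulr1 subrr.
have := fb _ yU' => /(congr1 (fun z => b e y *: e + z)).
rewrite addrC subrK => yE; rewrite [LHS]yE; congr (_ + _).
apply: eq_bigr => i _; rewrite liftK linearB linearZ /= (b_sym _ e).
by have := fU i; rewrite memU' => /andP[_ /eqP ->]; rewrite mulr0 subr0.
Qed.

(** A subspace invariant under a normal operator is invariant under its adjoint.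
For an orthonormal basis [f] of [U], [T f_i] lies in [U], so
[\sum_i |T f_i|^2] is the sum of the squared matrix coefficients of [T] on [U],
which are those of [T'] transposed; as [|T f_i| = |T' f_i|], nothing is left for
the components of the [T' f_i] orthogonal to [U]. *)
Lemma normal_stable (M U : {vspace L}) (T : L -> L) (T' : {linear L -> L}) :
    {in M, forall x, x != 0 -> 0 < b x x} -> (U <= M)%VS ->
    {in M, forall x, T x \in M} -> {in M, forall x, T' x \in M} ->
    {in M &, forall x y, b (T x) y = b x (T' y)} ->
    {in M, forall x, T (T' x) = T' (T x)} ->
    {in U, forall x, T x \in U} -> {in U, forall x, T' x \in U}.
Proof.
move=> Mpos /subvP UM TM T'M adj comm TU.
have [|k [f [fU fo fb]]] := @gram_schmidt U; first by move=> x /UM; exact: Mpos.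
pose r x := x - \sum_i b (f i) x *: f i.
have bDD s t : b t s = 0 -> b (s + t) (s + t) = b s s + b t t.
  move=> ts; rewrite linearD /= b_sym linearD /= b_sym ts addr0.
  by congr (_ + _); rewrite b_sym linearD /= ts add0r.
(* [r x] is the component of [x] orthogonal to [U]. *)
have pyth x : b x x = \sum_i b (f i) x ^+ 2 + b (r x) (r x).
  have bfr i : b (f i) (r x) = 0.
    rewrite linearB linear_sum /= (bigD1 i)//= big1 => [|j ji].
      by rewrite linearZ /= fo eqxx mulr1 addr0 subrr.
    by rewrite linearZ /= fo eq_sym (negbTE ji) mulr0.
  pose s := \sum_i b (f i) x *: f i.
  have xE : x = s + r x by rewrite addrC subrK.
  have bsr y : b y s = \sum_i b (f i) x * b y (f i).
    by rewrite linear_sum; apply: eq_bigr => i _; rewrite linearZ.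
  have brs : b (r x) s = 0.
    by rewrite bsr big1// => i _; rewrite (b_sym (r x)) bfr mulr0.
  rewrite {1 2}xE bDD//; congr (_ + _); rewrite bsr; apply: eq_bigr => i _.
  rewrite (b_sym s) bsr (bigD1 i)//= fo eqxx big1 ?addr0 ?mulr1// => j ji.
  by rewrite fo eq_sym (negbTE ji) mulr0.
have rM x : x \in M -> r x \in M.
  by move=> xM; rewrite memvB// memv_suml// => i _; rewrite memvZ ?UM.
have r_ge0 x : x \in M -> 0 <= b (r x) (r x).
  move=> /rM; have [->|rn0] := eqVneq (r x) 0; first by rewrite linear0.
  by move=> /Mpos/(_ rn0)/ltW.
have rU x : x \in U -> r x = 0.
  by move=> xU; rewrite /r {1}[x]fb ?subrr.
have norm x : x \in M -> b (T' x) (T' x) = b (T x) (T x).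
  by move=> xM; rewrite -adj ?T'M// comm// b_sym -adj ?TM// b_sym.
have sum_r : \sum_i b (r (T' (f i))) (r (T' (f i))) = 0.
  have fM i : f i \in M by exact: UM.
  have : \sum_i b (T' (f i)) (T' (f i)) = \sum_i b (T (f i)) (T (f i)).
    by apply: eq_bigr => i _; rewrite norm.
  rewrite (eq_bigr _ (fun i _ => pyth _)) [RHS](eq_bigr _ (fun i _ => pyth _)).
  rewrite !big_split /= [X in _ = _ + X]big1 => [|i _]; last first.
    by rewrite rU ?TU// linear0.
  rewrite addr0 /=.
  have -> : \sum_j \sum_i b (f i) (T' (f j)) ^+ 2 =
      \sum_j \sum_i b (f i) (T (f j)) ^+ 2.
    rewrite exchange_big /=; apply: eq_bigr => i _; apply: eq_bigr => j _.
    by rewrite -adj// b_sym.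
  by move=> /(canRL (addKr _)) ->; rewrite addNr.
have rf i : r (T' (f i)) = 0.
  move/eqP: sum_r; rewrite psumr_eq0 => [/allP/(_ i)|j _]; last first.
    by rewrite r_ge0// T'M// UM.
  rewrite mem_index_enum => /(_ isT)/= /eqP r0.
  apply: contra_eq r0 => rn0; rewrite gt_eqF// Mpos// rM// T'M// UM//.
move=> x xU; rewrite [x]fb// linear_sum memv_suml// => i _.
rewrite linearZ memvZ//= -[T' _]subr0 -(rf i) /r opprB addrC subrK.
by rewrite memv_suml// => j _; rewrite memvZ.
Qed.
End GramSchmidt.

(** * The Minkowski form, bivectors and skew endomorphisms *)
Section Minkowski.
Variables (R : realType) (n : nat).
Local Notation V := 'cV[R]_n.+2.
Local Notation gl := 'M[R]_n.+2.
Local Notation g := (@minkowski R n).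
Local Notation e0 := (time_axis R n).
Local Notation eta := (eta R n).
Implicit Types (u v w x y : V) (X Y A B T : gl) (U W : {vspace V}).
Implicit Types (h : {vspace gl}).

Lemma minkowskiC u v : g u v = g v u.
Proof. by rewrite minkowski_sym expr0 mul1r. Qed.

Lemma minkowskiDr u v w : g u (v + w) = g u v + g u w.
Proof. by have := minkowski_linear u 1 v w; rewrite !scale1r mul1r. Qed.

Lemma minkowski0r u : g u 0 = 0.
Proof.
by have := minkowski_linear u (-1) 0 0; rewrite scaler0 add0r mulN1r addNr.
Qed.

Lemma minkowskiZr u a v : g u (a *: v) = a * g u v.
Proof. by have := minkowski_linear u a v 0; rewrite !addr0 minkowski0r addr0. Qed.

Lemma minkowskiNr u v : g u (- v) = - g u v.
Proof. by rewrite -scaleN1r minkowskiZr mulN1r. Qed.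

Lemma minkowskiBr u v w : g u (v - w) = g u v - g u w.
Proof. by rewrite minkowskiDr minkowskiNr. Qed.

Lemma minkowskiDl u v w : g (v + w) u = g v u + g w u.
Proof. by rewrite minkowskiC minkowskiDr !(minkowskiC u). Qed.

Lemma minkowskiZl u a v : g (a *: v) u = a * g v u.
Proof. by rewrite minkowskiC minkowskiZr minkowskiC. Qed.

Lemma minkowski0l u : g 0 u = 0.
Proof. by rewrite minkowskiC minkowski0r. Qed.

Lemma minkowskiNl u v : g (- v) u = - g v u.
Proof. by rewrite minkowskiC minkowskiNr minkowskiC. Qed.

Lemma minkowskiBl u v w : g (v - w) u = g v u - g w u.
Proof. by rewrite minkowskiDl minkowskiNl. Qed.

Lemma minkowski_sumr u (I : Type) (r : seq I) P (F : I -> V) :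
  g u (\sum_(i <- r | P i) F i) = \sum_(i <- r | P i) g u (F i).
Proof.
by apply: (big_morph (g u)) => [x y|]; rewrite ?minkowskiDr ?minkowski0r.
Qed.

Lemma minkowski_suml u (I : Type) (r : seq I) P (F : I -> V) :
  g (\sum_(i <- r | P i) F i) u = \sum_(i <- r | P i) g (F i) u.
Proof.
by rewrite minkowskiC minkowski_sumr; apply: eq_bigr => i _; rewrite minkowskiC.
Qed.

(** Rewrite rules expanding the form by bilinearity. *)
Definition minkowski_bilin := (minkowskiDr, minkowskiDl, minkowskiBr, minkowskiBl,
  minkowskiNr, minkowskiNl, minkowskiZr, minkowskiZl).

Lemma minkowski_e0e0 : g e0 e0 = -1.
Proof.
rewrite /minkowski /e0 mxE mulr1 big1 ?addr0// => i _.
by rewrite !mxE mul0r.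
Qed.

(** The orthogonal complement of a timelike vector is positive definite; this is
the reversed Cauchy-Schwarz inequality. *)
Lemma timelike_perp t w : g t t < 0 -> g t w = 0 -> w != 0 -> 0 < g w w.
Proof.
rewrite /minkowski; set T := \sum_i _; set S := \sum_i _.
set Q := \sum_i w _ _ * _ => t0 tw wn0.
have Q0 : 0 <= Q by apply: sumr_ge0 => i _; rewrite -expr2 sqr_ge0.
have : 0 <= w 0 0 ^+ 2 * T - 2 * (w 0 0 * t 0 0) * S + t 0 0 ^+ 2 * Q.
  rewrite !mulr_sumr -sumrB -big_split /= sumr_ge0// => i _.
  set a := t _ 0; set b := w (lift _ _) 0.
  suff -> : w 0 0 ^+ 2 * (a * a) - 2 * (w 0 0 * t 0 0) * (a * b) +
     t 0 0 ^+ 2 * (b * b) = (w 0 0 * a - t 0 0 * b) ^+ 2 by rewrite sqr_ge0.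
  by ring.
have T0 : 0 <= T by apply: sumr_ge0 => i _; rewrite -expr2 sqr_ge0.
have -> : S = t 0 0 * w 0 0 by move: tw; lra.
have [w0|w0] := eqVneq (w 0 0) 0.
  move=> _; rewrite w0 mulr0 oppr0 add0r lt_neqAle Q0 andbT eq_sym.
  apply: contraNneq wn0 => /eqP; rewrite psumr_eq0 => [/allP q0|i _]; last first.
    by rewrite -expr2 sqr_ge0.
  apply/eqP/colP => i; rewrite mxE; case: (unliftP ord0 i) => [j ->|->//].
  by have := q0 j; rewrite mem_index_enum mulf_eq0 orbb => /(_ isT)/eqP.
have : 0 < w 0 0 ^+ 2 by rewrite exprn_even_gt0.
move: (w 0 0) (t 0 0) t0 => b a; rewrite -!expr2 => t0 b0 H.
have : 0 < a ^+ 2 * (Q - b ^+ 2) by nra.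
rewrite pmulr_rgt0; [lra | nra].
Qed.

#[local] Opaque minkowski.

Lemma minkowski_nondeg u : (forall v, g u v = 0) -> u = 0.
Proof.
move=> u0; apply/eqP/negPn/negP => un0.
have := @timelike_perp e0 u; rewrite minkowski_e0e0 (minkowskiC e0) !u0 ltrN10 ltxx.
by move/(_ isT erefl un0).
Qed.

(** Two orthogonal causal vectors are proportional. *)
Lemma causal_perp u v : u != 0 -> g u u <= 0 -> g v v <= 0 -> g u v = 0 ->
  exists c, v = c *: u.
Proof.
move=> un0 gu gv uv.
have e0u : g e0 u != 0.
  apply: contraTneq gu => e0u; rewrite -ltNge.
  by apply: (timelike_perp _ e0u) => //; rewrite minkowski_e0e0 ltrN10.
exists (g e0 v / g e0 u); apply/eqP; rewrite -subr_eq0; set w := v - _.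
apply: contraT => wn0; suff : 0 < g w w.
  rewrite /w !minkowski_bilin (minkowskiC v u) uv; move: (_ / _) => c.
  by have := mulr_ge0_le0 (sqr_ge0 c) gu; lra.
apply: (timelike_perp (t := e0)) => //; first by rewrite minkowski_e0e0 ltrN10.
by rewrite !minkowski_bilin divfK// subrr.
Qed.

Lemma null_perp u v : u != 0 -> g u u = 0 -> g u v = 0 -> 0 <= g v v.
Proof.
move=> un0 gu uv; rewrite leNgt; apply/negP => gv.
have gu0 : g u u <= 0 by rewrite gu.
have [c vE] := causal_perp un0 gu0 (ltW gv) uv.
by move: gv; rewrite vE !minkowski_bilin gu !mulr0 ltxx.
Qed.

Lemma null_perpP u v : u != 0 -> g u u = 0 -> g u v = 0 -> g v v = 0 ->
  exists c, v = c *: u.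
Proof. by move=> un0 gu uv gv; apply: causal_perp; rewrite ?gu ?gv. Qed.

Lemma causal_perp_ge0 u v : u != 0 -> g u u <= 0 -> g u v = 0 -> 0 <= g v v.
Proof.
move=> un0; rewrite le_eqVlt => /orP[/eqP gu|gu] uv; first exact: null_perp uv.
have [->|vn0] := eqVneq v 0; first by rewrite minkowski0r.
exact/ltW/(timelike_perp gu).
Qed.

(** Isotropic [p] and [q] normalized as the ends of a Witt basis. *)
Definition null_pair p q := [/\ g p p = 0, g q q = 0 & g p q = 1].

Lemma null_partner p : p != 0 -> g p p = 0 -> exists q, null_pair p q.
Proof.
move=> pn0 pp; have pe : g p e0 != 0.
  apply: contraNneq pn0 => pe; apply: contraT => pn0.
  have /timelike_perp : g e0 e0 < 0 by rewrite minkowski_e0e0 ltrN10.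
  by move=> /(_ p); rewrite minkowskiC pe pp ltxx => /(_ erefl pn0).
pose b := g p e0.
exists (b^-1 *: e0 + (2 * b ^+ 2)^-1 *: p).
split=> //; rewrite !minkowski_bilin ?(minkowskiC e0 p) pp -/b ?minkowski_e0e0.
  by field.
by field.
Qed.

Lemma mulmx_ext X Y : (forall v, X *m v = Y *m v) -> X = Y.
Proof.
move=> XY; apply/matrixP => i j.
have := congr1 (fun v : V => v i 0) (XY (delta_mx j 0)).
by rewrite -!colE !mxE.
Qed.

(** Skew-adjointness for the Minkowski form: membership in [so V]. *)
Definition skewadj X := forall u v, g (X *m u) v = - g u (X *m v).

Lemma mem_perp U u : reflect {in U, forall v, g u v = 0} (u \in perp U).
Proof. exact: mem_orthovP. Qed.

Lemma mem_so_full X : X \in so fullv <-> skewadj X.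
Proof.
split=> [/mem_soP[skX _] u v|skX].
  by apply/eqP; rewrite -subr_eq0 opprK skX.
apply/mem_soP; split=> [u v|w]; first by rewrite skX addNr.
move=> /mem_perp wp; rewrite [w]minkowski_nondeg ?mulmx0// => v.
by rewrite wp ?memvf.
Qed.

Lemma mem_so_perp U X : skewadj X -> {in U, forall w, X *m w = 0} ->
  {in perp (perp U), forall w, w \in U} -> X \in so (perp U).
Proof.
move=> skX X0 UU; apply/mem_soP; split=> [u v|w /UU/X0//].
by rewrite skX addNr.
Qed.

Lemma skewadjvv X u : skewadj X -> g u (X *m u) = 0.
Proof.
move=> sX; have := sX u u; rewrite minkowskiC => gX; lra.
Qed.

Lemma skewadjD X Y : skewadj X -> skewadj Y -> skewadj (X + Y).
Proof. move=> sX sY u v; rewrite !mulmxDl !minkowski_bilin sX sY; ring. Qed.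

Lemma skewadjN X : skewadj X -> skewadj (- X).
Proof. by move=> sX u v; rewrite !mulNmx !minkowski_bilin sX. Qed.

Lemma skewadjB X Y : skewadj X -> skewadj Y -> skewadj (X - Y).
Proof. by move=> sX sY; apply/skewadjD/skewadjN. Qed.

Lemma skewadjZ a X : skewadj X -> skewadj (a *: X).
Proof. by move=> sX u v; rewrite -!scalemxAl !minkowski_bilin sX mulrN. Qed.

Lemma skewadj_bracket X Y : skewadj X -> skewadj Y -> skewadj (bracket X Y).
Proof.
move=> sX sY u v; rewrite /bracket !mulmxBl -!mulmxA !minkowski_bilin !(sX, sY).
by ring.
Qed.

Lemma bracketE X Y v : bracket X Y *m v = X *m (Y *m v) - Y *m (X *m v).
Proof. by rewrite /bracket mulmxBl -!mulmxA. Qed.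

Lemma bracketC X Y : bracket X Y = - bracket Y X.
Proof. by rewrite /bracket opprB. Qed.

Lemma bracketNr X Y : bracket X (- Y) = - bracket X Y.
Proof. exact: linearN. Qed.

Lemma bracketDr X Y A : bracket X (Y + A) = bracket X Y + bracket X A.
Proof. exact: linearD. Qed.

Lemma skewadj_wedge u v : skewadj (wedge u v).
Proof.
move=> x y; rewrite !wedgeE !minkowski_bilin (minkowskiC x u) (minkowskiC x v); ring.
Qed.

Lemma wedgeC u v : wedge u v = - wedge v u.
Proof. by rewrite /wedge opprB. Qed.

Lemma wedgevv u : wedge u u = 0.
Proof. by rewrite /wedge subrr. Qed.

Lemma wedge_linear u : linear (wedge u).
Proof.
move=> a v w; apply: mulmx_ext => x.
rewrite [RHS]mulmxDl -scalemxAl !wedgeE !minkowski_bilin.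
apply/colP => i; rewrite !mxE; ring.
Qed.
HB.instance Definition _ u :=
  GRing.isLinear.Build R V gl *:%R (wedge u) (wedge_linear u).

Lemma wedgeDr u v w : wedge u (v + w) = wedge u v + wedge u w.
Proof. exact: linearD. Qed.
Lemma wedgeZr u a v : wedge u (a *: v) = a *: wedge u v.
Proof. exact: linearZ. Qed.
Lemma wedgeNr u v : wedge u (- v) = - wedge u v.
Proof. exact: linearN. Qed.
Lemma wedgeBr u v w : wedge u (v - w) = wedge u v - wedge u w.
Proof. exact: linearB. Qed.
Lemma wedge0r u : wedge u 0 = 0.
Proof. exact: linear0. Qed.
Lemma wedgeDl u v w : wedge (v + w) u = wedge v u + wedge w u.
Proof. by rewrite wedgeC wedgeDr opprD -!wedgeC. Qed.
Lemma wedgeZl u a v : wedge (a *: v) u = a *: wedge v u.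
Proof. by rewrite wedgeC wedgeZr -scalerN -wedgeC. Qed.
Lemma wedgeNl u v : wedge (- v) u = - wedge v u.
Proof. by rewrite wedgeC wedgeNr -wedgeC. Qed.
Lemma wedgeBl u v w : wedge (v - w) u = wedge v u - wedge w u.
Proof. by rewrite wedgeDl wedgeNl. Qed.
Lemma wedge0l u : wedge 0 u = 0.
Proof. by rewrite wedgeC wedge0r oppr0. Qed.

Lemma tr_wedge u v Y : \tr (wedge u v *m Y) = g u (Y *m v) - g v (Y *m u).
Proof.
rewrite /wedge mulmxBl linearB /= -!mulmxA mxtrace_mulC (mxtrace_mulC u).
by rewrite !minkowskiE !trace_mx11 !mulmxA.
Qed.

#[local] Opaque wedge.

(** The identification of [so V] with bivectors is equivariant. *)
Lemma bracket_wedge X u v : skewadj X ->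
  bracket X (wedge u v) = wedge (X *m u) v + wedge u (X *m v).
Proof.
move=> sX; apply: mulmx_ext => w; rewrite bracketE [RHS]mulmxDl !wedgeE.
rewrite mulmxBr -!scalemxAr !sX.
move: (X *m u) (X *m v) => Xu Xv; move: (g _ (X *m w)) (g _ _) => ? ?.
by apply/colP => i; rewrite !mxE; ring.
Qed.

(** * The Lorentz group and reflections *)
Lemma eta_sqr : eta *m eta = 1%:M.
Proof.
rewrite /Defs.eta mul_diag_mx; apply/matrixP => i j; rewrite !mxE.
by case: (i == ord0); rewrite ?mul1r ?mulN1r// mulNrn opprK.
Qed.

Lemma etaE v : eta *m v = v + (2 * g e0 v) *: e0.
Proof.
rewrite /Defs.eta mul_diag_mx; apply/colP => i; rewrite !mxE.
have -> : g e0 v = - v 0 0.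
  rewrite minkowskiE /Defs.eta -mulmxA mul_diag_mx /time_axis trmx_delta -rowE !mxE.
  by rewrite eqxx mulN1r.
by have [->|_] := eqVneq i ord0; rewrite ?eqxx /=; ring.
Qed.

Lemma skewadj_mx X : skewadj X -> X^T *m eta = - (eta *m X).
Proof.
move=> sX; apply/matrixP => i j.
have := sX (delta_mx i 0) (delta_mx j 0); rewrite !minkowskiE.
rewrite trmx_mul trmx_delta -!mulmxA -!rowE mulmxA -colE mulmxA -colE.
by rewrite !mxE.
Qed.

Lemma lorentzE T : lorentz_group T <-> forall u v, g (T *m u) (T *m v) = g u v.
Proof. by []. Qed.

Lemma lorentz_iso T u v : lorentz_group T -> g (T *m u) (T *m v) = g u v.
Proof. by move=> /lorentzE. Qed.

Lemma lorentz_unit T : lorentz_group T -> T \in unitmx.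
Proof.
move=> isoT; suff H : (eta *m T^T *m eta) *m T = 1%:M by case/mulmx1_unit: H.
apply: mulmx_ext => v; rewrite mul1mx; apply/eqP; rewrite -subr_eq0; apply/eqP.
apply: minkowski_nondeg => u; rewrite minkowskiBl.
apply/eqP; rewrite subr_eq0; apply/eqP.
rewrite minkowskiC (minkowskiC v) -(lorentz_iso u v isoT) !minkowskiE.
by rewrite trmx_mul !mulmxA -(mulmxA _ eta eta) eta_sqr mulmx1.
Qed.

Lemma lorentzK T v : lorentz_group T -> invmx T *m (T *m v) = v.
Proof. by move=> /lorentz_unit uT; rewrite mulmxA mulVmx ?mul1mx. Qed.

Lemma lorentzKV T v : lorentz_group T -> T *m (invmx T *m v) = v.
Proof. by move=> /lorentz_unit uT; rewrite mulmxA mulmxV ?mul1mx. Qed.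

Lemma lorentz_inv T u v : lorentz_group T -> g (T *m u) v = g u (invmx T *m v).
Proof. by move=> isoT; rewrite -{1}[v](lorentzKV _ isoT) lorentz_iso. Qed.

Lemma lorentz_invV T u v : lorentz_group T -> g (invmx T *m u) v = g u (T *m v).
Proof. by move=> isoT; rewrite minkowskiC -lorentz_inv// minkowskiC. Qed.

Lemma lorentzM T T' : lorentz_group T -> lorentz_group T' -> lorentz_group (T *m T').
Proof.
move=> iT iT'; apply/lorentzE => u v.
by rewrite -!mulmxA (lorentz_iso _ _ iT) (lorentz_iso _ _ iT').
Qed.

Lemma lorentzN T : lorentz_group T -> lorentz_group (- T).
Proof.
move=> iT; apply/lorentzE => u v.
by rewrite !mulNmx !minkowski_bilin opprK (lorentz_iso u v iT).
Qed.

Lemma skewadj_conj T X : lorentz_group T -> skewadj X -> skewadj (T *m X *m invmx T).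
Proof.
by move=> iT sX u v; rewrite -!mulmxA lorentz_inv// sX lorentz_invV.
Qed.

(** The reflection in the hyperplane orthogonal to a non-isotropic [m]. *)
Definition reflmx m : gl := 1%:M - (2 / g m m) *: (m *m m^T *m eta).

Lemma reflE m v : reflmx m *m v = v - (2 * g m v / g m m) *: m.
Proof.
rewrite mulmxBl mul1mx -scalemxAl -!mulmxA.
have -> : m^T *m (eta *m v) = (g m v)%:M.
  by rewrite [LHS]mx11_scalar minkowskiE mulmxA.
by rewrite mul_mx_scalar scalerA mulrAC.
Qed.

Lemma lorentz_refl m : g m m != 0 -> lorentz_group (reflmx m).
Proof.
move=> m0; apply/lorentzE => u v; rewrite !reflE !minkowski_bilin (minkowskiC u m).
by field.
Qed.

Lemma refl_diff u v : g u u = g v v -> g (u - v) (u - v) != 0 ->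
  reflmx (u - v) *m u = v.
Proof.
move=> uv duv; rewrite reflE; suff -> : 2 * g (u - v) u / g (u - v) (u - v) = 1.
  by rewrite scale1r opprB addrC subrK.
suff <- : g (u - v) (u - v) = 2 * g (u - v) u by rewrite divff.
by rewrite !minkowski_bilin (minkowskiC u v) -uv; ring.
Qed.

(** One of [u - v] and [u + v] is not isotropic, so that a reflection maps [u]
to [v] or to [- v]. *)
Lemma lorentz_map u v : g u u = g v v -> g u u != 0 ->
  exists T, lorentz_group T /\ T *m u = v.
Proof.
move=> uv un0; have [d0|d0] := eqVneq (g (u - v) (u - v)) 0; last first.
  by exists (reflmx (u - v)); split; [exact: lorentz_refl | exact: refl_diff].
have s0 : g (u - - v) (u - - v) != 0.
  suff -> : g (u - - v) (u - - v) = 4 * g u u by rewrite mulf_neq0 ?pnatr_eq0.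
  move: d0; rewrite !minkowski_bilin -uv; lra.
exists (- reflmx (u - - v)); split; first exact/lorentzN/lorentz_refl.
have uNv : g u u = g (- v) (- v) by rewrite !minkowski_bilin uv; ring.
by rewrite mulNmx (refl_diff uNv s0) opprK.
Qed.

(** Witt's theorem for null pairs: a first isometry matches the timelike vectors
[p' - q'] and [p - q]; in the positive definite complement of the latter, a
reflection matches the images of [p' + q'] and [p + q]. *)
Lemma lorentz_map_null_pair p q p' q' : null_pair p' q' -> null_pair p q ->
  exists T, [/\ lorentz_group T, T *m p' = p & T *m q' = q].
Proof.
move=> [pp' qq' pq'] [pp qq pq].
have [||T [iT Tpq]] := @lorentz_map (p' - q') (p - q).
- by rewrite !minkowski_bilin !(minkowskiC q p, minkowskiC q' p') pp' qq' pp qq pq pq'.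
- rewrite !minkowski_bilin !(minkowskiC q' p') pp' qq' pq'; lra.
pose x := T *m (p' + q'); pose y := p + q.
have xx : g x x = g y y.
  rewrite /x (lorentz_iso _ _ iT) !minkowski_bilin (minkowskiC q p) (minkowskiC q' p').
  by rewrite pp' qq' pp qq pq pq'.
have ax : g (p - q) x = 0.
  by rewrite -Tpq (lorentz_iso _ _ iT) !minkowski_bilin (minkowskiC q' p') pp' qq'; ring.
have ay : g (p - q) y = 0.
  by rewrite !minkowski_bilin (minkowskiC q p) pp qq; ring.
have aa : g (p - q) (p - q) < 0.
  by rewrite !minkowski_bilin (minkowskiC q p) pp qq pq; lra.
have [S [iS Sa Sx]] : exists S, [/\ lorentz_group S, S *m (p - q) = p - q & S *m x = y].
  have [xy|xy] := eqVneq x y.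
    exists 1%:M; rewrite !mul1mx; split=> //.
    by apply/lorentzE => u v; rewrite !mul1mx.
  have d0 : g (x - y) (x - y) != 0.
    by rewrite gt_eqF// (timelike_perp aa)// ?subr_eq0// minkowskiBr ax ay subrr.
  exists (reflmx (x - y)); split; [exact: lorentz_refl | | exact: refl_diff].
  by rewrite reflE minkowskiC minkowskiBr ax ay subrr mulr0 mul0r scale0r subr0.
exists (S *m T); split; first exact: lorentzM.
- have -> : p' = 2^-1 *: ((p' - q') + (p' + q')).
    by apply/colP => i; rewrite !mxE; field.
  rewrite -scalemxAr mulmxDr -!mulmxA Tpq Sa -/x Sx.
  by apply/colP => i; rewrite !mxE; field.
- have -> : q' = 2^-1 *: ((p' + q') - (p' - q')).
    by apply/colP => i; rewrite !mxE; field.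
  rewrite -scalemxAr mulmxBr -!mulmxA Tpq Sa -/x Sx.
  by apply/colP => i; rewrite !mxE; field.
Qed.

(** Conjugation by the reflection in a timelike vector is a Cartan involution:
combined with it, the trace form becomes definite.  When [t] is the time axis
the reflection is [eta] and the trace is minus the sum of the squared entries
of [X]. *)
Lemma tr_cartan t X : g t t < 0 -> skewadj X -> X != 0 ->
  \tr (X *m (reflmx t *m X *m reflmx t)) < 0.
Proof.
move=> t0 sX Xn0; pose c := Num.sqrt (- g t t).
have c2 : c ^+ 2 = - g t t by rewrite sqr_sqrtr// oppr_ge0 ltW.
have [||T [iT Tt]] := @lorentz_map t (c *: e0).
- by rewrite !minkowski_bilin minkowski_e0e0; lra.
- by rewrite lt_eqF.
have uT := lorentz_unit iT.
have TJ : T *m reflmx t = eta *m T.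
  apply: mulmx_ext => v; rewrite -!mulmxA etaE reflE mulmxBr -scalemxAr Tt scalerA.
  rewrite -(lorentz_iso t v iT) Tt minkowskiZl -scaleNr; congr (_ + _ *: _).
  have c0 : c != 0 by rewrite -sqrf_eq0 c2 oppr_eq0 lt_eqF.
  have -> : g t t = - c ^+ 2 by rewrite c2 opprK.
  by field.
have JE : reflmx t = invmx T *m eta *m T.
  by rewrite -mulmxA -TJ mulmxA mulVmx ?mul1mx.
pose Y := T *m X *m invmx T.
have sY : skewadj Y by exact: skewadj_conj.
have Yn0 : Y != 0.
  apply: contraNneq Xn0 => Y0; apply/eqP.
  have -> : X = invmx T *m (Y *m T) by rewrite /Y mulmxKV// mulKmx.
  by rewrite Y0 mul0mx mulmx0.
have -> : \tr (X *m (reflmx t *m X *m reflmx t)) = \tr (Y *m (eta *m Y *m eta)).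
  by rewrite JE /Y -!mulmxA [RHS]mxtrace_mulC -!mulmxA.
move: (Y) sY Yn0 => {JE}{}Y sY Yn0.
have -> : eta *m Y *m eta = - Y^T.
  have := skewadj_mx sY => /(congr1 (fun Z => Z *m eta)).
  by rewrite -mulmxA eta_sqr mulmx1 mulNmx => ->; rewrite opprK.
rewrite mulmxN linearN /= oppr_lt0 lt_neqAle; apply/andP; split.
  apply: contraNneq Yn0 => /esym tr0; apply/eqP/matrixP => i j; rewrite [RHS]mxE.
  move/eqP: tr0; rewrite psumr_eq0 => [/allP/(_ i)|k _]; last first.
    by rewrite mxE sumr_ge0// => l _; rewrite mxE -expr2 sqr_ge0.
  rewrite mem_index_enum mxE => /(_ isT)/=.
  rewrite psumr_eq0 => [/allP/(_ j)|l _]; last by rewrite mxE -expr2 sqr_ge0.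
  by rewrite mem_index_enum mxE mulf_eq0 orbb => /(_ isT)/eqP.
by rewrite sumr_ge0// => k _; rewrite mxE sumr_ge0// => l _; rewrite mxE -expr2 sqr_ge0.
Qed.

Lemma tr_sqr_elliptic t X : g t t < 0 -> skewadj X -> X *m t = 0 -> X != 0 ->
  \tr (X *m X) < 0.
Proof.
move=> t0 sX Xt Xn0; suff -> : \tr (X *m X) = \tr (X *m (reflmx t *m X *m reflmx t)).
  exact: tr_cartan.
suff XE : reflmx t *m X *m reflmx t = X by rewrite XE.
apply: mulmx_ext => v; rewrite -!mulmxA (reflE t v) mulmxBr -scalemxAr Xt scaler0.
rewrite subr0 reflE -[g t _]opprK -sX Xt minkowski0l oppr0 mulr0 mul0r.
by rewrite scale0r subr0.
Qed.


(** * Endomorphisms without nonzero real eigenvalue *)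

(** Criticality of an interior minimum: with [e = g v v], [c = g v u],
[d = g u u], and with [b = F v u], [f = F u u] for a form [F] vanishing at
[v], moving from [v] to [v + s *: u] stays causal and makes [F] negative,
unless [b = 0]. *)
Lemma quadratic_descent (e c d f b : R) : e < 0 -> b != 0 ->
  exists s, e + 2 * s * c + s ^+ 2 * d <= 0 /\ 2 * s * b + s ^+ 2 * f < 0.
Proof.
move=> e0 b0; pose K := 2 * `|b * c| + b ^+ 2 * `|d|.
have K0 : 0 <= K.
  have := mulr_ge0 (sqr_ge0 b) (normr_ge0 d).
  by have := normr_ge0 (b * c); rewrite /K; lra.
have b2 : 0 < b ^+ 2 by rewrite exprn_even_gt0.
pose D := - e + K + - e * `|f|.
have ef : 0 <= - e * `|f| by rewrite mulr_ge0// oppr_ge0 ltW.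
have D0 : 0 < D by rewrite /D; lra.
pose r := - e / D.
have r0 : 0 < r by rewrite divr_gt0// oppr_gt0.
have rD : r * D = - e by rewrite /r divfK// gt_eqF.
have r1 : r <= 1 by rewrite ler_pdivrMr// mul1r /D; lra.
have rK : r * K <= - e by rewrite -rD ler_pM2l// /D; lra.
have rf : r * `|f| <= 1.
  rewrite -(ler_pM2l (x := - e)) ?oppr_gt0// mulr1 -{2}rD mulrCA ler_pM2l//.
  by rewrite /D; lra.
exists (- (b * r)); split.
  have : - (b * c) <= `|b * c| by rewrite ler_normr lexx orbT.
  have : d <= `|d| by exact: ler_norm.
  move=> dl bcl.
  have h1 : r * - (b * c) <= r * `|b * c| by rewrite ler_pM2l.
  have h2 : (b ^+ 2 * r) * d <= (b ^+ 2 * r) * `|d| by rewrite ler_pM2l// mulr_gt0.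
  have h3 : r * ((b ^+ 2 * r) * `|d|) <= 1 * ((b ^+ 2 * r) * `|d|).
    apply: ler_wpM2r r1; apply: mulr_ge0 (normr_ge0 d).
    by rewrite ltW// mulr_gt0.
  have h4 : r * ((b ^+ 2 * r) * d) <= r * ((b ^+ 2 * r) * `|d|) by rewrite ler_pM2l.
  have -> : e + 2 * - (b * r) * c + (- (b * r)) ^+ 2 * d =
    e + 2 * (r * - (b * c)) + r * ((b ^+ 2 * r) * d) by ring.
  by move: rK; rewrite /K mulrDr; lra.
have fl : f <= `|f| by exact: ler_norm.
have -> : 2 * - (b * r) * b + (- (b * r)) ^+ 2 * f = b ^+ 2 * r * (r * f - 2) by ring.
rewrite pmulr_rlt0; last exact: mulr_gt0.
have : r * f <= r * `|f| by rewrite ler_pM2l.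
lra.
Qed.

Lemma quad_gram X v : quad (X^T *m eta *m X) v = g (X *m v) (X *m v).
Proof. by rewrite /quad minkowskiE trmx_mul !mulmxA. Qed.

(** The variational principle.  At a null minimum the sum of the
[g (A_i v) (A_i v)] vanishes, which forces each [A_i v] to be null and
orthogonal to [v], hence proportional to it. *)
Lemma skewadj_family_eigen k (A : 'I_k -> gl) : (forall i, skewadj (A i)) ->
  exists v, v != 0 /\
   ((g v v = 0 /\ forall i, exists c, A i *m v = c *: v) \/
    (g v v < 0 /\ exists2 mu, 0 <= mu & \sum_i A i *m (A i *m v) = mu *: v)).
Proof.
move=> sA; pose M := \sum_i (A i)^T *m eta *m A i.
have quadM v : quad M v = \sum_i g (A i *m v) (A i *m v).
  rewrite /quad mulmx_sumr mulmx_suml summxE; apply: eq_bigr => i _.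
  exact: quad_gram.
have Age0 i v : v != 0 -> g v v <= 0 -> 0 <= g (A i *m v) (A i *m v).
  by move=> vn0 gv; apply: (causal_perp_ge0 vn0) => //; rewrite skewadjvv.
have [v gv|v [mu [vn0 gv mu0 F0 F_ge0]]] := @causal_pencil R n M.
  have [->|vn0] := eqVneq v 0.
    by rewrite /quad !mulmx0 mxE.
  by rewrite quadM sumr_ge0// => i _; exact: Age0.
exists v; split=> //.
move: gv; rewrite le_eqVlt => /orP[/eqP gv|gv]; [left|right]; split=> //.
  move=> i; apply: null_perpP => //; first by rewrite skewadjvv.
  move/eqP: F0; rewrite gv mulr0 addr0 quadM psumr_eq0 => [/allP/(_ i)|j _].
    by rewrite mem_index_enum => /(_ isT)/eqP.
  by rewrite Age0// gv.
exists mu => //; apply/eqP; rewrite eq_sym -subr_eq0; apply/eqP.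
apply: minkowski_nondeg => u.
rewrite minkowskiBl minkowskiZl minkowski_suml.
under eq_bigr do rewrite (sA _ _ _).
rewrite sumrN opprK; set b := _ + _.
apply/eqP/negPn/negP => b0.
have [s [gs Fs]] := quadratic_descent (g v u) (g u u) (quad M u + mu * g u u) gv b0.
have gvs : g (v + s *: u) (v + s *: u) <= 0.
  suff -> : g (v + s *: u) (v + s *: u) = g v v + 2 * s * g v u + s ^+ 2 * g u u by [].
  by rewrite !minkowski_bilin (minkowskiC u v); ring.
have := F_ge0 _ gvs; rewrite leNgt => /negP; apply.
suff -> : quad M (v + s *: u) + mu * g (v + s *: u) (v + s *: u) =
  (quad M v + mu * g v v) + (2 * s * b + s ^+ 2 * (quad M u + mu * g u u)).
  by rewrite F0 add0r.
have -> : quad M (v + s *: u) = quad M v +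
    2 * s * (\sum_i g (A i *m v) (A i *m u)) + s ^+ 2 * quad M u.
  rewrite !quadM !mulr_sumr -!big_split /=; apply: eq_bigr => i _.
  rewrite mulmxDr -scalemxAr !minkowski_bilin (minkowskiC (A i *m u) (A i *m v)); ring.
rewrite /b !minkowski_bilin (minkowskiC u v); ring.
Qed.

(** No nonzero real eigenvalue. *)
Definition nonhyperbolic X := forall v c, v != 0 -> X *m v = c *: v -> c = 0.

(** A causal [v] killed by [X] is found first.  If [v] is timelike, [X] is a skew
endomorphism of a Euclidean space.  If [v] is null, [X] is the sum of
[v /\ a] and of a skew endomorphism [C] of a Euclidean space, and
[\tr (X ^ 2) = \tr (C ^ 2)]. *)
Lemma tr_sqr_nonhyperbolic X : skewadj X -> nonhyperbolic X ->
  \tr (X *m X) <= 0 /\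
  (\tr (X *m X) = 0 -> X = 0 \/ exists p a,
     [/\ p != 0, g p p = 0, g p a = 0 & X = wedge p a]).
Proof.
move=> sX nX; have [|v [vn0 [[gv Xv]|[gv [mu mu0 Xv]]]]] :=
  @skewadj_family_eigen 1 (fun=> X); first by [].
  have {}Xv : X *m v = 0.
    have [c Xv'] := Xv ord0; have := nX _ _ vn0 Xv'.
    by rewrite Xv' => ->; rewrite scale0r.
  have [q [_ qq vq]] := null_partner vn0 gv.
  pose a := X *m q.
  have va : g v a = 0 by rewrite /a -[g v _]opprK -sX Xv minkowski0l oppr0.
  have qa : g q a = 0 by rewrite /a skewadjvv.
  have [C [sC Cv Cq XE]] : exists C : gl,
      [/\ skewadj C, C *m v = 0, C *m q = 0 & X = wedge v a + C].
    exists (X - wedge v a); split.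
    - exact/skewadjB/skewadj_wedge.
    - by rewrite mulmxBl Xv wedgeE gv (minkowskiC a) va !scale0r !subr0.
    - by rewrite mulmxBl wedgeE vq (minkowskiC a) qa scale0r scale1r subr0 subrr.
    - by rewrite addrC subrK.
  have tr_wa : \tr (wedge v a *m wedge v a) = 0.
    rewrite tr_wedge !wedgeE gv va (minkowskiC a v) va !minkowski_bilin va gv; ring.
  have tr_wC : \tr (wedge v a *m C) = 0.
    by rewrite tr_wedge Cv minkowski0r -[g v _]opprK -sC Cv minkowski0l oppr0 addr0.
  have trX : \tr (X *m X) = \tr (C *m C).
    rewrite {1 2}XE; move: (wedge v a) tr_wa tr_wC => w tr_wa tr_wC.
    rewrite mulmxDr !mulmxDl !mxtraceD tr_wa tr_wC.
    by rewrite (mxtrace_mulC C) tr_wC !add0r.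
  have tt : g (v - q) (v - q) < 0.
    by rewrite !minkowski_bilin (minkowskiC q v) gv qq vq; lra.
  have Ct : C *m (v - q) = 0 by rewrite mulmxBr Cv Cq subr0.
  have [C0|Cn0] := eqVneq C 0.
    rewrite trX C0 mulmx0 mxtrace0; split=> // _; right; exists v, a.
    by split=> //; rewrite XE C0 addr0.
  have := tr_sqr_elliptic tt sC Ct Cn0; rewrite trX => lt0; split; first exact: ltW.
  by move=> tr0; move: lt0; rewrite tr0 ltxx.
move: Xv; rewrite big_ord1 => XXv.
have Xv : X *m v = 0.
  pose s := Num.sqrt mu.
  have s2 : s * s = mu by rewrite -expr2 sqr_sqrtr.
  have [s0|sn0] := eqVneq s 0.
    move: XXv; rewrite -s2 s0 mulr0 scale0r => XXv.
    have [//|Xvn0] := eqVneq (X *m v) 0.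
    have := timelike_perp gv (skewadjvv v sX) Xvn0.
    by rewrite sX XXv minkowski0r oppr0 ltxx.
  (* As [X ^ 2 v = s ^ 2 v], the vector [X v + s v] is zero or an eigenvector of
     eigenvalue [s]. *)
  have [Xvs|Xvs] := eqVneq (X *m v + s *: v) 0.
    move: sn0; rewrite -oppr_eq0 => /eqP[]; apply: (nX v) => //.
    by apply/eqP; rewrite -subr_eq0 scaleNr opprK Xvs.
  case/eqP: sn0; apply: (nX _ _ Xvs).
  by rewrite mulmxDr XXv -scalemxAr scalerDr scalerA s2 addrC.
have [->|Xn0] := eqVneq X 0; first by rewrite mulmx0 mxtrace0; split=> //; left.
have := tr_sqr_elliptic gv sX Xv Xn0 => lt0; split; first exact: ltW.
by move=> tr0; move: lt0; rewrite tr0 ltxx.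
Qed.

(** Closure under the bracket, the second clause of being a Lie subalgebra. *)
Definition bracket_closed h := forall X Y, X \in h -> Y \in h -> bracket X Y \in h.

(** With [b = Y p], the element [[p /\ a, Y]] maps [p] to [- g a b p], so
[g a b = 0]; then [[p /\ a, [p /\ a, Y]] = g a a (b /\ p)], and its bracket with
[Y] maps [p] to [g a a * g b b p].  So [b] is null and orthogonal to [p]. *)
Lemma nilpotent_fixes h p a : {in h, forall X, skewadj X} -> bracket_closed h ->
    {in h, forall X, nonhyperbolic X} -> p != 0 -> g p p = 0 -> g p a = 0 ->
    wedge p a != 0 -> wedge p a \in h ->
  {in h, forall Y, Y *m p = 0}.
Proof.
move=> sh lh nh pn0 pp pa wn0 wh Y Yh.
have aa : g a a != 0.
  apply: contraNneq wn0 => /(null_perpP pn0 pp pa)[c ->].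
  by rewrite wedgeZr wedgevv scaler0.
have sY := sh _ Yh; pose b := Y *m p.
have pb : g p b = 0 by rewrite skewadjvv.
have ab : g a b = 0.
  apply/oppr_inj; rewrite oppr0; apply: (nh _ (lh _ _ wh Yh) p) => //.
  rewrite bracketE -/b !wedgeE pb pp (minkowskiC a p) pa !scale0r subr0 mulmx0 subr0.
  by rewrite sub0r scaleNr.
pose X' := bracket (wedge p a) (bracket (wedge p a) Y).
have X'h : X' \in h by apply/lh/lh.
have X'E : X' = g a a *: wedge b p.
  rewrite /X' (bracketC _ Y) (bracket_wedge p a sY) -/b bracketNr bracketDr.
  rewrite !bracket_wedge; try exact: skewadj_wedge.
  rewrite !wedgeE pb ab pa pp (minkowskiC a p) pa.
  rewrite -[g p (Y *m a)]opprK -sY -/b (minkowskiC b) ab oppr0.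
  rewrite !(scale0r, subr0, sub0r, wedge0l, wedgeNr, wedgeZr, wedgevv, scaler0).
  by rewrite !(wedge0l, add0r, addr0, oppr0, opprK).
have bb : g b b = 0.
  have : g a a * g b b = 0.
    apply: (nh _ (lh _ _ X'h Yh) p) => //.
    rewrite bracketE -/b X'E -!scalemxAl !wedgeE pp (minkowskiC b p) pb !scale0r.
    by rewrite subrr scaler0 mulmx0 !subr0 scalerA.
  by move/eqP; rewrite mulf_eq0 (negbTE aa) => /eqP.
have [c bE] := null_perpP pn0 pp pb bb.
by rewrite -/b bE (nh _ Yh _ _ pn0 bE) scale0r.
Qed.

(** * Projections onto Lorentzian subspaces *)

(** The orthogonal projection onto a subspace containing a timelike vector. *)
Lemma projection_exists U t : t \in U -> g t t < 0 ->
  exists P : gl, [/\ forall v, P *m v \in U,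
    forall v, v - P *m v \in perp U & 0 < \tr P].
Proof.
move=> tU gt.
pose M := (U :&: perp <[t]>)%VS.
have memM v : (v \in M) = (v \in U) && (g t v == 0).
  by rewrite memv_cap mem_orthov1 minkowskiC.
have gtn0 : g t t != 0 by rewrite lt_eqF.
have [||v|k [f [fM fo fM']]] := @gram_schmidt R V g _ _ M.
- exact: minkowskiC.
- exact: minkowski_linear.
- by rewrite memM => /andP[_ /eqP] /(timelike_perp gt).
have fU i : f i \in U by have := fM i; rewrite memM => /andP[].
have ft i : g t (f i) = 0 by have := fM i; rewrite memM => /andP[_ /eqP].
pose P := (g t t)^-1 *: (t *m t^T *m eta) +
          \sum_i f i *m (f i)^T *m eta.
have rank1 (x v : V) : x *m x^T *m eta *m v = g x v *: x.
  rewrite -!mulmxA; have -> : x^T *m (eta *m v) = (g x v)%:M.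
    by rewrite [LHS]mx11_scalar minkowskiE mulmxA.
  by rewrite mul_mx_scalar.
have PE v : P *m v = (g t v / g t t) *: t + \sum_i g (f i) v *: f i.
  rewrite mulmxDl mulmx_suml -scalemxAl rank1 scalerA mulrC.
  by congr (_ + _); apply: eq_bigr => i _; rewrite rank1.
exists P; split=> [v|v|].
- by rewrite PE memvD ?memvZ ?memv_suml// => i _; rewrite memvZ.
- rewrite PE; apply/mem_perp => u uU.
  have uM : u - (g t u / g t t) *: t \in M.
    by rewrite memM memvB ?memvZ//= !minkowski_bilin divfK// subrr.
  rewrite -[u](subrK ((g t u / g t t) *: t)); set w := u - _ in uM *.
  have gtw : g t w = 0 by move: uM; rewrite memM => /andP[_ /eqP].
  have resE y : g (v - (g t v / g t t *: t + \sum_i g (f i) v *: f i)) y =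
      g v y - g t v / g t t * g t y - \sum_i g (f i) v * g (f i) y.
    rewrite minkowskiBl minkowskiDl minkowskiZl minkowski_suml opprD addrA.
    by congr (_ - _); apply: eq_bigr => i _; rewrite minkowskiZl.
  rewrite minkowskiDr minkowskiZr !resE gtw mulr0 subr0.
  rewrite divfK// (minkowskiC v t) subrr sub0r.
  rewrite [\sum_i _ * g _ t]big1 => [|i _]; last by rewrite (minkowskiC _ t) ft mulr0.
  rewrite oppr0 mulr0 addr0 {1}(fM' _ uM) minkowski_sumr.
  apply/eqP; rewrite subr_eq0; apply/eqP; apply: eq_bigr => i _.
  by rewrite minkowskiZr mulrC (minkowskiC v).
have trE (x : V) : \tr (x *m x^T *m eta) = g x x.
  by rewrite -mulmxA mxtrace_mulC trace_mx11 minkowskiE.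
rewrite linearD linearZ linear_sum /= trE mulVf//.
rewrite (eq_bigr (fun=> 1)) => [|i _]; last by rewrite trE fo eqxx.
by rewrite ltr_wpDr// sumr_ge0.
Qed.

Section Projection.
Variables (U : {vspace V}) (t : V) (P : gl).
Hypotheses (tU : t \in U) (tt : g t t < 0).
Hypotheses (PU : forall v, P *m v \in U) (Pperp : forall v, v - P *m v \in perp U).

Lemma capv_perp w : w \in U -> w \in perp U -> w = 0.
Proof.
move=> wU /mem_perp wp; apply/eqP; apply: contraT => wn0.
have tw : g t w = 0 by rewrite minkowskiC wp.
by have := timelike_perp tt tw wn0; rewrite wp// ltxx.
Qed.

Lemma proj_id u : u \in U -> P *m u = u.
Proof.
move=> uU; apply/eqP; rewrite eq_sym -subr_eq0; apply/eqP.
by apply: capv_perp => //; apply: memvB.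
Qed.

Lemma proj_perp w : w \in perp U -> P *m w = 0.
Proof.
move=> wp; apply: capv_perp => //.
by rewrite -[P *m w](subKr w) memvB.
Qed.

Lemma perp_perp w : w \in perp (perp U) -> w \in U.
Proof.
move=> /mem_perp wpp; have := Pperp w => wP.
suff /eqP : w - P *m w = 0 by rewrite subr_eq0 => /eqP ->.
apply/eqP; apply: contraT => wn0.
have tw : g t (w - P *m w) = 0 by rewrite minkowskiC; move/mem_perp: wP; apply.
have := timelike_perp tt tw wn0; rewrite minkowskiBl wpp// sub0r.
by rewrite minkowskiC; move/mem_perp: wP => ->//; rewrite oppr0 ltxx.
Qed.

Lemma proj_selfadj u v : g (P *m u) v = g u (P *m v).
Proof.
have E x y : g (P *m x) y = g (P *m x) (P *m y).
  apply/eqP; rewrite -subr_eq0 -minkowskiBr minkowskiC.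
  by move/mem_perp: (Pperp y) => ->.
by rewrite E minkowskiC -E minkowskiC.
Qed.

Lemma skewadj_perp X : skewadj X -> {in U, forall u, X *m u \in U} ->
  {in perp U, forall w, X *m w \in perp U}.
Proof.
move=> sX XU w /mem_perp wp; apply/mem_perp => u uU.
by rewrite sX wp ?oppr0// XU.
Qed.

Lemma proj_comm X : skewadj X -> {in U, forall u, X *m u \in U} ->
  X *m P = P *m X.
Proof.
move=> sX XU; apply: mulmx_ext => v; rewrite -!mulmxA.
rewrite -[in RHS](subrK (P *m v) v) mulmxDr mulmxDr.
by rewrite [P *m (X *m (v - _))]proj_perp ?skewadj_perp// add0r [RHS]proj_id ?XU.
Qed.

Lemma skewadj_proj X : skewadj X -> {in U, forall u, X *m u \in U} ->
  skewadj (X *m P).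
Proof.
move=> sX XU u v; rewrite -!mulmxA sX proj_selfadj.
by congr (- g _ _); rewrite !mulmxA proj_comm.
Qed.

End Projection.

(** * Fixed vectors of algebras without hyperbolic elements *)

(** The opposite of the trace form, an invariant symmetric form. *)
Definition trace_form (A B : gl) : R := - \tr (A *m B).

Lemma trace_form_sym A B :
  trace_form A B = (-1) ^+ false * idfun (trace_form B A).
Proof. by rewrite expr0 mul1r /trace_form mxtrace_mulC. Qed.

Lemma trace_form_linear A : GRing.linear_for *%R (trace_form A).
Proof.
by move=> a B C; rewrite /trace_form mulmxDr -scalemxAr mxtraceD mxtraceZ; ring.
Qed.

Lemma trace_form_bilinear : bilinear_for
  (GRing.Scale.Law.clone _ _ *%R _)
  (GRing.Scale.Law.clone _ _ (idfun \; *%R) _) trace_form.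
Proof.
split=> [B|A] a x y /=; last exact: trace_form_linear.
rewrite trace_form_sym expr0 mul1r /= trace_form_linear.
by congr (_ * _ + _); rewrite trace_form_sym expr0 mul1r.
Qed.

HB.instance Definition _ :=
  bilinear_isBilinear.Build R gl gl R _ _ trace_form trace_form_bilinear.
HB.instance Definition _ :=
  isHermitianSesquilinear.Build R gl false idfun trace_form trace_form_sym.

(** [ad Y] is skew for the trace form. *)
Lemma trace_form_bracket X Y A :
  trace_form X (bracket Y A) = - trace_form A (bracket Y X).
Proof.
rewrite /trace_form /bracket !mulmxBr !(raddfB (@mxtrace R n.+2)) /= !mulmxA.
have -> : \tr (X *m Y *m A) = \tr (A *m X *m Y) by rewrite mxtrace_mulC mulmxA.
have -> : \tr (X *m A *m Y) = \tr (A *m Y *m X) by rewrite -mulmxA mxtrace_mulC.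
by ring.
Qed.



(** An algebra of skew endomorphisms without hyperbolic elements kills a nonzero
causal vector. *)
Lemma fixes_causal h : {in h, forall X, skewadj X} -> bracket_closed h ->
    {in h, forall X, nonhyperbolic X} ->
  exists v, [/\ v != 0, g v v <= 0 & {in h, forall X, X *m v = 0}].
Proof.
move=> sh lh nh.
have [[X [Xh Xn0 trX]]|noX] :=
    pselect (exists X, [/\ X \in h, X != 0 & \tr (X *m X) = 0]).
  have [_ /(_ trX)[X0|[p [a [pn0 pp pa XE]]]]] :=
    tr_sqr_nonhyperbolic (sh _ Xh) (nh _ Xh).
    by rewrite X0 eqxx in Xn0.
  exists p; split; rewrite ?pp//.
  by apply: (@nilpotent_fixes h p a) => //; rewrite -XE.
pose b := trace_form.
have bpos : {in h, forall X, X != 0 -> 0 < b X X}.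
  move=> X Xh Xn0; rewrite oppr_gt0 lt_neqAle.
  have [-> _] := tr_sqr_nonhyperbolic (sh _ Xh) (nh _ Xh); rewrite andbT.
  by apply/eqP => trX; apply: noX; exists X.
have b_sym X Y : b X Y = b Y X by rewrite /b /trace_form mxtrace_mulC.
have b_lin X : GRing.linear_for *%R (b X) := trace_form_linear X.
have [k [f [fh fo fE]]] := gram_schmidt b_sym b_lin bpos.
have sf i : skewadj (f i) by exact: sh.
have [v [vn0 [[gv fv]|[gv [mu mu0 fv]]]]] := skewadj_family_eigen sf.
  exists v; split; rewrite ?gv// => X Xh; rewrite (fE _ Xh) mulmx_suml big1// => i _.
  have [c fc] := fv i; have c0 := nh _ (fh i) _ _ vn0 fc.
  by rewrite -scalemxAl fc c0 scale0r scaler0.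
have [mu00|mun0] := eqVneq mu 0.
  exists v; split; rewrite ?ltW// => X Xh; rewrite (fE _ Xh) mulmx_suml big1// => i _.
  have gf_ge0 j : 0 <= g (f j *m v) (f j *m v).
    by apply: (causal_perp_ge0 vn0 (ltW gv)); rewrite skewadjvv.
  suff fv0 : f i *m v = 0 by rewrite -scalemxAl fv0 scaler0.
  apply/eqP; apply: contraT => fvn0.
  have := timelike_perp gv (skewadjvv v (sf i)) fvn0.
  have sum0 : \sum_j g (f j *m v) (f j *m v) = 0.
    under eq_bigr do rewrite (sf _ _ _).
    by rewrite sumrN -minkowski_sumr fv mu00 scale0r minkowski0r oppr0.
  move/eqP: sum0; rewrite psumr_eq0 => [/allP/(_ i)|//].
  by rewrite mem_index_enum => /(_ isT)/eqP ->; rewrite ltxx.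
(* [Om] is the Casimir operator for the orthonormal basis [f]. *)
pose Om := \sum_i f i *m f i.
have OmE u : Om *m u = \sum_i f i *m (f i *m u).
  by rewrite mulmx_suml; apply: eq_bigr => i _; rewrite mulmxA.
have OmC Y : Y \in h -> Y *m Om = Om *m Y.
  move=> Yh; pose c j i := b (f j) (bracket Y (f i)).
  have cC i j : c j i = - c i j by rewrite /c /b trace_form_bracket.
  have brE i : bracket Y (f i) = \sum_j c j i *: f j by exact/fE/lh.
  apply/eqP; rewrite -subr_eq0; apply/eqP.
  have -> : Y *m Om - Om *m Y =
      \sum_i (bracket Y (f i) *m f i + f i *m bracket Y (f i)).
    rewrite mulmx_sumr mulmx_suml -sumrB; apply: eq_bigr => i _.
    by rewrite /bracket mulmxBl mulmxBr !mulmxA addrA subrK.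
  rewrite big_split /=.
  have -> : \sum_i f i *m bracket Y (f i) = - \sum_i bracket Y (f i) *m f i.
    have -> : \sum_i f i *m bracket Y (f i) = \sum_i \sum_j c j i *: (f i *m f j).
      apply: eq_bigr => i _; rewrite brE mulmx_sumr.
      by apply: eq_bigr => j _; rewrite -scalemxAr.
    rewrite exchange_big -sumrN /=; apply: eq_bigr => i _.
    rewrite brE mulmx_suml -sumrN; apply: eq_bigr => j _.
    by rewrite -scalemxAl cC scaleNr.
  by rewrite subrr.
(* [mu > 0]: the traces of the squares of the [f_i] on the eigenspace [U] have
   a nonpositive and a positive sum.  Restricting to [U] is done by composing
   with the projection [P], which keeps everything in [so V]. *)
pose U := lker (linfun (mulmx (Om - mu%:M) : V -> V)).
have memU u : (u \in U) = (Om *m u == mu *: u).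
  by rewrite memv_ker lfunE /= mulmxBl mul_scalar_mx subr_eq0.
have vU : v \in U by rewrite memU OmE fv.
have hU X : X \in h -> {in U, forall u, X *m u \in U}.
  move=> Xh u; rewrite !memU => /eqP uU.
  by rewrite mulmxA -OmC// -mulmxA uU scalemxAr.
have [P [PU Pperp trP]] := projection_exists vU gv.
have nP i : nonhyperbolic (f i *m P).
  move=> w c wn0; rewrite -mulmxA => fPw; apply: contraTeq isT => cn0.
  have wU : w \in U.
    rewrite -[w]scale1r -(mulVf cn0) -scalerA -fPw memvZ//.
    exact: (hU _ (fh i)).
  move: cn0; rewrite (proj_id vU gv PU Pperp wU) in fPw.
  by rewrite (nh _ (fh i) _ _ wn0 fPw) eqxx.
have : \sum_i \tr ((f i *m P) *m (f i *m P)) <= 0.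
  rewrite sumr_le0// => i _.
  have sfP := skewadj_proj vU gv PU Pperp (sf i) (hU _ (fh i)).
  by have [] := tr_sqr_nonhyperbolic sfP (nP i).
have -> : \sum_i \tr ((f i *m P) *m (f i *m P)) = \tr (Om *m P).
  rewrite mulmx_suml raddf_sum; apply: eq_bigr => i _; congr (\tr _).
  rewrite -!mulmxA; congr (_ *m _); rewrite mulmxA.
  rewrite -(proj_comm vU gv PU Pperp (sf i) (hU _ (fh i))) -mulmxA.
  congr (_ *m _); apply: mulmx_ext => u; rewrite -mulmxA.
  by rewrite (proj_id vU gv PU Pperp (PU u)).
have -> : Om *m P = mu *: P.
  apply: mulmx_ext => u; rewrite -mulmxA -scalemxAl.
  by have := PU u; rewrite memU => /eqP.
by rewrite mxtraceZ leNgt mulr_gt0// lt_neqAle eq_sym mun0.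
Qed.

Lemma perpK U t w : t \in U -> g t t < 0 -> w \in perp (perp U) -> w \in U.
Proof.
by move=> tU tt; have [P [PU Pp _]] := projection_exists tU tt; apply: (perp_perp tU tt PU Pp).
Qed.

(** The only consequence of total reducibility that is used: every invariant null
line has an invariant line transversal to its orthogonal hyperplane.  It involves
no subspaces besides lines, so that it is easily transported by conjugation. *)
Definition null_reducible h := forall q, q != 0 -> g q q = 0 ->
  (forall X, X \in h -> exists c, X *m q = c *: q) ->
  exists2 u, g q u = 1 & forall X, X \in h -> exists c, X *m u = c *: u.

(** An invariant complement of the hyperplane orthogonal to [q] is a line: if
[X q = c q], then [X u + c u] lies both in the complement and in the
hyperplane. *)
Lemma totally_reducible_null h : {in h, forall X, skewadj X} ->
  totally_reducible h -> null_reducible h.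
Proof.
move=> sh trh q qn0 qq hq.
have memqp u : (u \in perp <[q]>) = (g q u == 0).
  by rewrite mem_orthov1 minkowskiC.
have [|U' [U'h Ufull Ucap]] := trh (perp <[q]>%VS).
  move=> X u Xh; rewrite !memqp => /eqP qu; have [c Xq] := hq _ Xh.
  by rewrite -[g q _]opprK -(sh _ Xh) Xq minkowskiZl qu mulr0 oppr0.
have [u uU' qu] : exists2 u, u \in U' & g q u != 0.
  have [r [_ _ qr]] := null_partner qn0 qq.
  have := memvf r; rewrite -Ufull => /memv_addP[a aq [u uU' rE]].
  exists u => //; move/eqP: qr; rewrite rE minkowskiDr.
  by move: aq; rewrite memqp => /eqP ->; rewrite add0r => /eqP ->; exact: oner_neq0.
exists ((g q u)^-1 *: u); first by rewrite minkowskiZr mulVf.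
move=> X Xh; have [c Xq] := hq _ Xh; exists (- c).
rewrite -scalemxAr [RHS]scalerA mulrC -scalerA; congr (_ *: _).
apply/eqP; rewrite -subr_eq0 -memv0 -Ucap memv_cap memqp.
rewrite scaleNr opprK memvD ?U'h ?memvZ// andbT minkowskiDr minkowskiZr.
by rewrite -[g q (X *m u)]opprK -(sh _ Xh) Xq minkowskiZl addNr.
Qed.

(** If the fixed causal vector [v] is null, the transversal invariant line
is also killed, and its sum with the line of [v] contains timelike vectors. *)
Lemma fixes_timelike h : {in h, forall X, skewadj X} -> bracket_closed h ->
    {in h, forall X, nonhyperbolic X} -> null_reducible h ->
  exists2 t, g t t < 0 & {in h, forall X, X *m t = 0}.
Proof.
move=> sh lh nh redh; have [v [vn0 gv hv]] := fixes_causal sh lh nh.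
move: gv; rewrite le_eqVlt => /orP[/eqP gv|]; last by exists v.
have [X Xh|u vu hu] := redh v vn0 gv; first by exists 0; rewrite hv// scale0r.
exists (u - ((g u u + 1) / 2) *: v).
  by rewrite !minkowski_bilin (minkowskiC u v) gv vu; lra.
move=> X Xh; rewrite mulmxBr -scalemxAr (hv _ Xh) scaler0 subr0.
have [c Xu] := hu _ Xh.
have : g v (X *m u) = 0 by rewrite -[g v _]opprK -(sh _ Xh) hv// minkowski0l oppr0.
by rewrite Xu minkowskiZr vu mulr1 => ->; rewrite scale0r.
Qed.


(** * Conjugation *)
Lemma conj_skewadj T h : lorentz_group T -> {in h, forall X, skewadj X} ->
  {in conj_lie T h, forall X, skewadj X}.
Proof. by move=> iT sh X /mem_conj_lie[Y Yh ->]; apply/skewadj_conj/sh. Qed.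

Lemma bracket_conj T X Y : T \in unitmx ->
  bracket (T *m X *m invmx T) (T *m Y *m invmx T) =
  T *m bracket X Y *m invmx T.
Proof.
by move=> uT; rewrite /bracket mulmxBr mulmxBl !mulmxA !mulmxKV.
Qed.

Lemma conj_bracket_closed T h : T \in unitmx -> bracket_closed h ->
  bracket_closed (conj_lie T h).
Proof.
move=> uT lh X Y /mem_conj_lie[X' Xh ->] /mem_conj_lie[Y' Yh ->].
by rewrite bracket_conj//; apply/mem_conj_lie; exists (bracket X' Y') => //; exact: lh.
Qed.

Lemma conj_null_reducible T h : lorentz_group T -> null_reducible h ->
  null_reducible (conj_lie T h).
Proof.
move=> iT redh q qn0 qq hq; have uT := lorentz_unit iT.
have [||X Xh|u qu hu] := redh (invmx T *m q).
- apply: contraNneq qn0 => Kq; by rewrite -[q](lorentzKV _ iT) Kq mulmx0.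
- by rewrite lorentz_invV// lorentzKV.
- have [|c Xq] := hq (T *m X *m invmx T); first by apply/mem_conj_lie; exists X.
  exists c; rewrite scalemxAr -Xq -!mulmxA lorentzK//.
exists (T *m u); first by rewrite -lorentz_invV.
move=> Y /mem_conj_lie[X Xh ->]; have [c Xu] := hu _ Xh; exists c.
by rewrite -!mulmxA lorentzK// Xu scalemxAr.
Qed.

(** * Weights of the boost of a null pair *)
Section NullPair.
Variables (p q : V).
Hypothesis pq : null_pair p q.

Let pp : g p p = 0. Proof. by case: pq. Qed.
Let qq : g q q = 0. Proof. by case: pq. Qed.
Let gpq : g p q = 1. Proof. by case: pq. Qed.
Let gqp : g q p = 1. Proof. by rewrite minkowskiC. Qed.

Lemma null_pair_timelike : g (p - q) (p - q) < 0.
Proof. by rewrite !minkowski_bilin pp qq gpq gqp; lra. Qed.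

Lemma null_pair_neq0 : p != 0.
Proof. by apply: contra_eqN gpq => /eqP ->; rewrite minkowski0l eq_sym oner_eq0. Qed.

Lemma boost_p : wedge p q *m p = - p.
Proof. by rewrite wedgeE pp gqp scale0r scale1r sub0r. Qed.

Lemma boost_q : wedge p q *m q = q.
Proof. by rewrite wedgeE gpq qq scale0r scale1r subr0. Qed.

Lemma mem_eucl w : (w \in eucl p q) = (g p w == 0) && (g q w == 0).
Proof.
apply/mem_perp/andP => [wp|[/eqP pw /eqP qw] _
    /memv_addP[_ /vlineP[a ->] [_ /vlineP[b ->] ->]]].
  by split; rewrite minkowskiC wp// memvE (addvSl, addvSr).
by rewrite minkowskiC !minkowski_bilin pw qw !mulr0 addr0.
Qed.

Lemma mem_so_eucl X : X \in so (eucl p q) <->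
  [/\ skewadj X, X *m p = 0 & X *m q = 0].
Proof.
split=> [/mem_soP[sX X0]|[sX Xp Xq]].
  split=> [u v||]; first by apply/eqP; rewrite -subr_eq0 opprK sX.
    by apply: X0; apply/mem_perp => w; rewrite mem_eucl => /andP[/eqP].
  by apply: X0; apply/mem_perp => w; rewrite mem_eucl => /andP[_ /eqP].
apply: mem_so_perp => // w.
  move=> /memv_addP[_ /vlineP[a ->] [_ /vlineP[b ->] ->]].
  by rewrite mulmxDr -!scalemxAr Xp Xq !scaler0 addr0.
apply: (perpK _ null_pair_timelike); apply: memv_add; rewrite ?memvN memv_line//.
Qed.

(** [ad (p /\ q)] has eigenvalue -1 on the bivectors [p /\ w], 1 on the
[q /\ w] and 0 on [R (p /\ q) + so E]; so if [h] is stable under it, it contains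
the component of [X] of weight -1. *)
Lemma graded_component h X : {in h, forall X, skewadj X} ->
    {in h, forall X, bracket (wedge p q) X \in h} ->
  X \in h -> wedge p (X *m q - g p (X *m q) *: q) \in h.
Proof.
move=> sh gh Xh; have sX := sh _ Xh.
pose x := g p (X *m q); pose a := X *m q - x *: q.
pose b := X *m p + x *: p.
have Xq : X *m q = a + x *: q by rewrite subrK.
have Xp : X *m p = b - x *: p by rewrite addrK.
have pa : g p a = 0 by rewrite /a minkowskiBr minkowskiZr gpq mulr1 subrr.
have qa : g q a = 0.
  by rewrite /a minkowskiBr minkowskiZr qq mulr0 subr0 skewadjvv.
have pb : g p b = 0 by rewrite /b minkowskiDr minkowskiZr pp mulr0 addr0 skewadjvv.
have qb : g q b = 0.
  by rewrite /b minkowskiDr minkowskiZr gqp mulr1 /x minkowskiC sX addrC minkowskiC subrr.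
(* [D ^ 2 - D] is twice the projection onto weight -1, for [D = ad (p /\ q)]. *)
have DX : bracket (wedge p q) X = wedge q b - wedge p a.
  rewrite bracketC bracket_wedge// Xp Xq wedgeBl wedgeDr wedgeZl wedgeZr.
  rewrite addrACA addNr addr0 opprD (wedgeC b) opprK//.
have DDX : bracket (wedge p q) (bracket (wedge p q) X) = wedge q b + wedge p a.
  rewrite DX bracketDr bracketNr !bracket_wedge; try exact: skewadj_wedge.
  rewrite boost_p boost_q !wedgeE pb qb pa qa !scale0r subrr !wedge0r !addr0.
  by rewrite wedgeNl opprK.
have -> : wedge p a = 2^-1 *: (bracket (wedge p q) (bracket (wedge p q) X) -
    bracket (wedge p q) X).
  rewrite DDX DX opprD opprK addrACA subrr add0r -mulr2n.
  rewrite -(scaler_nat 2 (wedge p a)) scalerA.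
  by rewrite mulVf ?scale1r// pnatr_eq0.
by rewrite memvZ// memvB// !gh.
Qed.

(** [[p /\ w, q /\ w']] is the first bivector of the conclusion, and its bracket
with [p /\ w] is [p /\ (g w w w' - 2 (g w w') w)]. *)
Lemma weight_transfer h w w' : {in h, forall X, skewadj X} -> bracket_closed h ->
    w \in eucl p q -> w' \in eucl p q -> w != 0 ->
    wedge p w \in h -> wedge q w' \in h ->
  wedge w w' + g w w' *: wedge p q \in h /\ wedge p w' \in h.
Proof.
move=> sh lh; rewrite !mem_eucl => /andP[/eqP pw /eqP qw] /andP[/eqP pw' /eqP qw'].
move=> wn0 wh wh'.
have wp : g w p = 0 by rewrite minkowskiC.
have wq : g w q = 0 by rewrite minkowskiC.
pose Y := wedge w w' + g w w' *: wedge p q.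
have YE : bracket (wedge p w) (wedge q w') = Y.
  rewrite bracket_wedge; last exact: skewadj_wedge.
  rewrite !wedgeE gpq wq pw' !scale0r scale1r subr0 sub0r wedgeNr wedgeZr.
  by rewrite (wedgeC q) scalerN opprK.
have Yh : Y \in h by rewrite -YE; exact: lh.
split=> //.
have Yw : bracket Y (wedge p w) = g w w *: wedge p w' - (2 * g w w') *: wedge p w.
  rewrite bracket_wedge; last by apply/skewadjD/skewadjZ/skewadj_wedge; exact: skewadj_wedge.
  have -> : Y *m p = - g w w' *: p.
    rewrite [LHS]mulmxDl -scalemxAl boost_p wedgeE wp (minkowskiC w' p) pw'.
    by rewrite !scale0r subrr add0r scalerN scaleNr.
  have -> : Y *m w = g w w *: w' - g w w' *: w.
    rewrite [LHS]mulmxDl -scalemxAl !wedgeE pw qw !scale0r subrr scaler0 addr0.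
    by rewrite (minkowskiC w' w).
  rewrite wedgeBr !wedgeZr wedgeZl; move: (wedge p w) (wedge p w') => A B.
  by apply/matrixP => i j; rewrite !mxE; ring.
have ww : g w w != 0.
  have tw : g (p - q) w = 0 by rewrite minkowskiBl pw qw subrr.
  by rewrite gt_eqF// (timelike_perp null_pair_timelike).
have -> : wedge p w' = (g w w)^-1 *: (bracket Y (wedge p w) + (2 * g w w') *: wedge p w).
  by rewrite Yw subrK scalerA mulVf// scale1r.
by rewrite memvZ// memvD ?memvZ//; apply: lh.
Qed.

End NullPair.


(** Write [d = D + C] with [D = p /\ q] and [C] in [so E].  The reflection [J] in
[p - q] exchanges [p] and [q], and conjugation by it maps [D] to [- D] and fixes
[C]; so for the form [- \tr (X J Y J)] the adjoint of [ad d] is [ad d'] with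
[d' = D - C = 2 D - d], and the two commute. *)
Lemma boost_stable p q h d : null_pair p q -> {in h, forall X, skewadj X} ->
    bracket_closed h -> d \in h -> d *m p = - p -> d *m q = q ->
  {in h, forall X, bracket (wedge p q) X \in h}.
Proof.
move=> pq sh lh dh dp dq.
have [pp qq gpq] := pq; have gqp : g q p = 1 by rewrite minkowskiC.
have sd := sh _ dh.
pose D := wedge p q; have sD : skewadj D by exact: skewadj_wedge.
pose d' := 2 *: D - d.
have sd' : skewadj d' by apply/skewadjB => //; exact: skewadjZ.
pose m := p - q; have mm : g m m < 0 by exact: null_pair_timelike.
have mm2 : g m m = -2 by rewrite /m !minkowski_bilin pp qq gpq gqp; ring.
pose J := reflmx m.
have JE v : J *m v = v + g m v *: m.
  by rewrite reflE mm2 -scaleNr; congr (_ + _ *: _); field.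
have JJ : J *m J = 1%:M.
  apply: mulmx_ext => v; rewrite -mulmxA mul1mx JE JE.
  rewrite (minkowskiDr m v) (minkowskiZr m _ m) mm2.
  by apply/colP => i; rewrite !mxE; ring.
have JdJ : J *m d *m J = - d'.
  apply: mulmx_ext => v; rewrite -!mulmxA (JE v) mulmxDr -scalemxAr.
  have dm : d *m m = - (p + q) by rewrite mulmxBr dp dq opprD.
  rewrite dm JE (minkowskiDr m (d *m v)) -[g m (d *m v)]opprK -sd dm.
  rewrite mulNmx mulmxBl -scalemxAl wedgeE /m !minkowski_bilin pp qq gpq gqp.
  by move: (d *m v) (g p v) (g q v) => dv a b; apply/colP => i; rewrite !mxE; ring.
have Jpos X : skewadj X -> X != 0 -> \tr (X *m (J *m X *m J)) < 0.
  exact: tr_cartan.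
have d'E : d' = 2 *: D - d by [].
move: (J) (d') JJ JdJ Jpos d'E sd' => {JE}{}J {}d' JJ JdJ Jpos d'E sd'.
have Jd : J *m d = - (d' *m J).
  by rewrite -mulNmx -JdJ -(mulmxA (J *m d)) JJ mulmx1.
have dJ : d *m J = - (J *m d').
  by rewrite -mulmxN -JdJ !mulmxA JJ mul1mx.
have dD : d *m D = D *m d.
  apply/eqP; rewrite -subr_eq0; apply/eqP.
  change (bracket d D = 0).
  by rewrite bracket_wedge// dp dq wedgeNl addNr.
pose b X Y := - \tr (X *m (J *m Y *m J)).
have b_sym X Y : b X Y = b Y X.
  by rewrite /b !mulmxA mxtrace_mulC !mulmxA mxtrace_mulC !mulmxA.
have b_lin X : GRing.linear_for *%R (b X).
  move=> a Y Z; rewrite /b mulmxDr mulmxDl mulmxDr -scalemxAr -scalemxAl -scalemxAr.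
  by rewrite mxtraceD mxtraceZ; ring.
have so_skew X : X \in so fullv -> skewadj X by move/mem_so_full.
have d'h : {in h, forall X, bracket d' X \in h}.
  apply: (@normal_stable R gl b b_sym b_lin (so fullv) h (bracket d) (bracket d')).
  - by move=> X /so_skew sX Xn0; rewrite oppr_gt0; exact: Jpos.
  - by apply/subvP => X /sh sX; apply/mem_so_full.
  - by move=> X /so_skew sX; apply/mem_so_full/skewadj_bracket.
  - by move=> X /so_skew sX; apply/mem_so_full/skewadj_bracket.
  - move=> X Y _ _; rewrite /b; congr (- _).
    rewrite /bracket mulmxBl mulmxBr mulmxBl mulmxBr !linearB /=.
    rewrite (mulmxA J d') -[J *m d' *m Y *m J]mulmxA.
    have -> : J *m d' = - (d *m J) by rewrite dJ opprK.
    have -> : J *m (Y *m d') *m J = - (J *m Y *m J *m d).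
      by rewrite -!mulmxA Jd !mulmxN opprK.
    rewrite !mulNmx !mulmxN !linearN /= opprK addrC; congr (_ + _).
      by rewrite !mulmxA.
    by rewrite -!mulmxA mxtrace_mulC !mulmxA.
  - move=> X _; have dd : d *m d' = d' *m d.
      by rewrite d'E mulmxBr mulmxBl -scalemxAr -scalemxAl dD.
    have ddE u : d *m (d' *m u) = d' *m (d *m u) by rewrite !mulmxA dd.
    apply: mulmx_ext => v; rewrite !bracketE !mulmxBr !ddE.
    by apply/colP => i; rewrite !mxE; ring.
  - by move=> X Xh; exact: lh.
move=> X Xh.
have -> : bracket (wedge p q) X = 2^-1 *: (bracket d X + bracket d' X).
  rewrite -/D; move: (D) d'E => E d'E.
  apply: mulmx_ext => v; rewrite -scalemxAl [X in _ *: X]mulmxDl !bracketE.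
  rewrite d'E !mulmxBl -!scalemxAl !mulmxBr -!scalemxAr.
  move: (d *m (X *m v)) (X *m (d *m v)) => x1 x2.
  move: (E *m (X *m v)) (X *m (E *m v)) => x3 x4.
  by apply/colP => i; rewrite !mxE; field.
by rewrite memvZ// memvD ?d'h// lh.
Qed.

(** * Algebras preserving two null lines: type III *)
Lemma tr_sqr_so_eucl p q X : null_pair p q -> X \in so (eucl p q) -> X != 0 ->
  \tr (X *m X) < 0.
Proof.
move=> pq /(mem_so_eucl pq)[sX Xp Xq]; apply: tr_sqr_elliptic sX _.
  exact: null_pair_timelike pq.
by rewrite mulmxBr Xp Xq subr0.
Qed.

(** [k] is the ideal of the elements of [h] killing [p] and [q].  With [d1] the
component of [d] orthogonal to [k] for the trace form, [[X, d1]] is in [k] for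
[X] in [k] and has norm 0 by invariance of the form. *)
Lemma typeIII_of_lines p q h d : null_pair p q -> {in h, forall X, skewadj X} ->
    bracket_closed h -> d \in h -> d *m p = - p -> d *m q = q ->
    (forall X, X \in h -> exists c, X *m p = c *: p) ->
    (forall X, X \in h -> exists c, X *m q = c *: q) ->
  typeIII p q h.
Proof.
move=> pq sh lh dh dp dq hp hq.
have [pp qq gpq] := pq; have gqp : g q p = 1 by rewrite minkowskiC.
pose k := (h :&: so (eucl p q))%VS.
have memk X : (X \in k) = (X \in h) && (X \in so (eucl p q)) by rewrite memv_cap.
have kE X : X \in h -> X *m p = 0 -> X *m q = 0 -> X \in k.
  by move=> Xh Xp Xq; rewrite memk Xh; apply/mem_so_eucl => //; split => //; exact: sh.
have kh X : X \in k -> [/\ X \in h, X *m p = 0 & X *m q = 0].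
  by rewrite memk => /andP[Xh /(mem_so_eucl pq)[_ Xp Xq]].
have ks X : X \in k -> X \in so (eucl p q) by rewrite memk => /andP[].
have lk X Y : X \in k -> Y \in h -> bracket X Y \in k.
  move=> /kh[Xh Xp Xq] Yh; apply: kE; first exact: lh.
    by have [c Yp] := hp _ Yh; rewrite bracketE Xp Yp -scalemxAr Xp mulmx0 scaler0 subr0.
  by have [c Yq] := hq _ Yh; rewrite bracketE Xq Yq -scalemxAr Xq mulmx0 scaler0 subr0.
pose b := trace_form.
have b_sym X Y : b X Y = b Y X by rewrite /b /trace_form mxtrace_mulC.
have b_lin X : GRing.linear_for *%R (b X) := trace_form_linear X.
have bpos : {in k, forall X, X != 0 -> 0 < b X X}.
  by move=> X /ks Xs Xn0; rewrite oppr_gt0; exact: tr_sqr_so_eucl Xs Xn0.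
have [m [f [fk fo fE]]] := gram_schmidt b_sym b_lin bpos.
pose s := \sum_i b (f i) d *: f i.
have sk : s \in k by rewrite memv_suml// => i _; rewrite memvZ.
have [s_h s_p s_q] := kh _ sk.
pose d1 := d - s.
have d1h : d1 \in h by rewrite memvB.
have d1p : d1 *m p = - p by rewrite mulmxBl s_p subr0.
have d1q : d1 *m q = q by rewrite mulmxBl s_q subr0.
have bD X Y Z : b X (Y + Z) = b X Y + b X Z.
  by have := b_lin X 1 Y Z; rewrite scale1r mul1r.
have b0 X : b X 0 = 0 by rewrite /b /trace_form mulmx0 mxtrace0 oppr0.
have bZ X a Y : b X (a *: Y) = a * b X Y.
  by have := b_lin X a Y 0; rewrite addr0 b0 addr0.
have bs j : b (f j) s = b (f j) d.
  rewrite (big_morph (b (f j)) (bD _) (b0 _)) (bigD1 j)//= bZ fo eqxx mulr1.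
  by rewrite big1 ?addr0// => i ij; rewrite bZ fo eq_sym (negbTE ij) mulr0.
have d1perp X : X \in k -> \tr (X *m d1) = 0.
  move=> /fE XE; apply/eqP; rewrite -oppr_eq0 -[- _]/(b X d1) b_sym XE.
  rewrite (big_morph (b d1) (bD d1) (b0 d1)) big1// => i _.
  have -> : d1 = d + (-1) *: s by rewrite scaleN1r.
  by rewrite bZ (b_sym _ (f i)) bD bZ bs mulN1r subrr mulr0.
pose C0 := d1 - wedge p q.
have C0s : C0 \in so (eucl p q).
  apply/mem_so_eucl => //; split.
  - by apply/skewadjB/skewadj_wedge/sh.
  - by rewrite mulmxBl d1p (boost_p pq) subrr.
  - by rewrite mulmxBl d1q (boost_q pq) subrr.
have dE : wedge p q + C0 = d1 by rewrite addrC subrK.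
have d1k X : X \in k -> bracket X d1 = 0.
  move=> Xk; have Xdk := lk _ _ Xk d1h; apply/eqP; apply: contraT => Xdn0.
  have := tr_sqr_so_eucl pq (ks _ Xdk) Xdn0.
  rewrite -{2}[bracket X d1]opprK -bracketC mulmxN linearN /=.
  move: (bracket X d1) Xdk {Xdn0} => Z Zk.
  have [Xh _ _] := kh _ Xk.
  have -> : \tr (Z *m bracket d1 X) = \tr (bracket X Z *m d1).
    move: (d1) => d2; rewrite /bracket mulmxBr mulmxBl !linearB /= !mulmxA.
    by congr (_ - _); rewrite mxtrace_mulC mulmxA.
  rewrite d1perp ?oppr0 ?ltxx//; apply: lk => //.
  by have [] := kh _ Zk.
exists C0, k; rewrite dE; split=> //.
- split; last by move=> X Y Xk /kh[Yh _ _]; exact: lk.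
  apply/subvP => X Xk; rewrite memv_cap ks//= memv_ker lfunE /=.
  have [Xh Xp Xq] := kh _ Xk.
  rewrite bracketC oppr_eq0; apply/eqP.
  have -> : C0 = d1 - wedge p q by [].
  rewrite bracketDr bracketNr d1k// (bracket_wedge p q (sh _ Xh)) Xp Xq.
  by rewrite wedge0l wedge0r addr0 subr0.
- apply/eqP; rewrite -subv0; apply/subvP => X; rewrite memv_cap memv0.
  move=> /andP[/vlineP[c ->] /kh[_ + _]].
  rewrite -scalemxAl d1p => /eqP; rewrite scaler_eq0 oppr_eq0.
  by rewrite (negbTE (null_pair_neq0 pq)) orbF => /eqP ->; rewrite scale0r.
- apply/vspaceP => X; apply/idP/memv_addP => [Xh|[_ /vlineP[c ->] [Y /kh[Yh _ _] ->]]].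
    have [c Xp] := hp _ Xh; have [c' Xq] := hq _ Xh.
    have cc : c = - c'.
      have := sh _ Xh p q; rewrite Xp Xq minkowskiZl minkowskiZr gpq; lra.
    exists (c' *: d1); first by rewrite memvZ// memv_line.
    exists (X - c' *: d1); last by rewrite addrC subrK.
    apply: kE; first by rewrite memvB// memvZ.
      by rewrite mulmxBl -scalemxAl Xp d1p cc scalerN scaleNr subrr.
    by rewrite mulmxBl -scalemxAl Xq d1q subrr.
  by rewrite memvD ?memvZ.
Qed.


(** * Algebras with both weights: type II *)
Lemma compact_lie_elliptic t h : g t t < 0 -> {in h, forall X, skewadj X} ->
  {in h, forall X, X *m t = 0} -> compact_lie h.
Proof.
move=> tt sh ht; exists trace_form; split=> [X Xh Xn0|A B C _ _ _].
  by have := tr_sqr_elliptic tt (sh _ Xh) (ht _ Xh) Xn0; rewrite -oppr_gt0.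
rewrite /= /trace_form /bracket mulmxBl mulmxBr !linearB /= !mulmxA.
by rewrite (mxtrace_mulC (B *m C)) !mulmxA; ring.
Qed.

(** [H] is the space [N] of the [w] in [E] with [p /\ w] in [h], equivalently
with [q /\ w] in [h].  All bivectors of [W = R p + N + R q] lie in [h], and [h]
preserves [W]; the second summand is the set of elements of [h] that kill
[W]. *)
Lemma typeII_of_weights p q h w1 w2 : null_pair p q ->
    {in h, forall X, skewadj X} -> bracket_closed h ->
    {in h, forall X, bracket (wedge p q) X \in h} ->
    w1 \in eucl p q -> w1 != 0 -> wedge p w1 \in h ->
    w2 \in eucl p q -> w2 != 0 -> wedge q w2 \in h ->
  typeII p q h.
Proof.
move=> pq sh lh gh w1E w1n0 w1h w2E w2n0 w2h.
have [pp qq gpq] := pq; have gqp : g q p = 1 by rewrite minkowskiC.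
have qp : null_pair q p by [].
have euclC : eucl q p = eucl p q by rewrite /eucl addvC.
have gh' : {in h, forall X, bracket (wedge q p) X \in h}.
  move=> X Xh; rewrite bracketC (wedgeC q p) bracketNr opprK -[bracket _ _]opprK.
  by rewrite -bracketC memvN gh.
pose t := p - q; have tt : g t t < 0 := null_pair_timelike pq.
pose N := (eucl p q :&: (linfun (wedge p) @^-1: h))%VS.
have memN w : (w \in N) = (w \in eucl p q) && (wedge p w \in h).
  by rewrite memv_cap -memv_preim lfunE.
have NE w : w \in N -> w \in eucl p q by rewrite memN => /andP[].
have NP w : w \in N -> wedge p w \in h by rewrite memN => /andP[].
have NQ w : w \in N -> wedge q w \in h.
  move=> wN; have wE : w \in eucl q p by rewrite euclC NE.
  have w2E' : w2 \in eucl q p by rewrite euclC.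
  by have [_ ->] := weight_transfer qp sh lh w2E' wE w2n0 w2h (NP _ wN).
have QN w : w \in eucl p q -> wedge q w \in h -> w \in N.
  move=> wE wh; rewrite memN wE.
  by have [_ ->] := weight_transfer pq sh lh w1E wE w1n0 w1h wh.
have w1N : w1 \in N by rewrite memN w1E.
have pN w : w \in N -> g p w = 0.
  by move=> /NE; rewrite mem_eucl => /andP[/eqP].
have qN w : w \in N -> g q w = 0.
  by move=> /NE; rewrite mem_eucl => /andP[_ /eqP].
have Npos : {in N, forall w, w != 0 -> 0 < g w w}.
  move=> w wN; apply: (timelike_perp tt).
  by rewrite minkowskiBl pN// qN// subrr.
have Dh : wedge p q \in h.
  have [+ _] := weight_transfer pq sh lh w1E w1E w1n0 w1h (NQ _ w1N).
  rewrite wedgevv add0r => /(memvZ (g w1 w1)^-1).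
  by rewrite scalerA mulVf ?scale1r // (gt_eqF (Npos _ w1N w1n0)).
have NNh w w' : w \in N -> w' \in N -> wedge w w' \in h.
  move=> wN w'N; have [->|wn0] := eqVneq w 0; first by rewrite wedge0l mem0v.
  have [+ _] := weight_transfer pq sh lh (NE _ wN) (NE _ w'N) wn0 (NP _ wN) (NQ _ w'N).
  by move=> /memvB/(_ (memvZ (g w w') Dh)); rewrite addrK.
pose W := (<[p]> + N + <[q]>)%VS.
have pW : p \in W by rewrite memvE /W -addvA addvSl.
have qW : q \in W by rewrite memvE /W addvSr.
have NW w : w \in N -> w \in W.
  move=> wN; rewrite memvE /W; apply: subv_trans (addvSl _ _).
  by apply: subv_trans (addvSr _ _); rewrite -memvE.
have WP x : x \in W -> exists a b w, w \in N /\ x = a *: p + w + b *: q.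
  move=> /memv_addP[_ /memv_addP[_ /vlineP[a ->] [w wN ->]] [_ /vlineP[b ->] ->]].
  by exists a, b, w.
have WI y : y - g q y *: p - g p y *: q \in N -> y \in W.
  move=> yN; have -> : y = (y - g q y *: p - g p y *: q) + g q y *: p + g p y *: q.
    by apply/colP => i; rewrite !mxE; ring.
  by rewrite memvD ?memvZ// memvD ?memvZ// NW.
have tW : t \in W by rewrite memvB.
have wedgeW u v : u \in W -> v \in W -> wedge u v \in h.
  have key x : wedge x p \in h -> (forall w, w \in N -> wedge x w \in h) ->
      wedge x q \in h -> forall y, y \in W -> wedge x y \in h.
    move=> xp xN xq y /WP[a [b [w [wN ->]]]].
    by rewrite !wedgeDr !wedgeZr memvD ?memvZ// memvD ?memvZ// xN.
  have flip x y : wedge x y \in h -> wedge y x \in h by rewrite wedgeC memvN.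
  have kpW : forall y, y \in W -> wedge p y \in h.
    by apply: key => //; rewrite wedgevv mem0v.
  have kqW : forall y, y \in W -> wedge q y \in h.
    by apply: key => //; rewrite ?wedgevv ?mem0v//; exact: flip.
  have kNW w : w \in N -> forall y, y \in W -> wedge w y \in h.
    move=> wN; apply: key => [|w' w'N|]; last by apply/flip/NQ.
      by apply/flip/NP.
    exact: NNh.
  by move=> uW; apply: key => [|w wN|]; apply: flip; [exact: kpW|exact: kNW|exact: kqW].
have [P [PW Pperp _]] := projection_exists tW tt.
have soWP X : X \in so W -> [/\ skewadj X, {in perp W, forall w, X *m w = 0}
    & forall v, X *m v \in W].
  move=> /mem_soP[sX0 X0]; have sX : skewadj X.
    by move=> u v; apply/eqP; rewrite -subr_eq0 opprK sX0.
  split=> // v; apply: (perpK tW tt); apply/mem_perp => z zW.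
  by rewrite sX X0// minkowski0r oppr0.
have soWh X : X \in so W -> X \in h.
  move=> /soWP[sX X0 XW].
  have [k [f [fN fo fE]]] := gram_schmidt minkowskiC (@minkowski_linear R n) Npos.
  (* [I] is the orthogonal projection onto [W], written in the basis [p], [f],
     [q]; [X] is half the contraction of [u /\ X u] with the inverse form of
     [W]. *)
  pose I v := g q v *: p + g p v *: q + \sum_i g (f i) v *: f i.
  have II v : v \in W -> I v = v.
    move=> /WP[a [b [w [wN ->]]]]; rewrite /I !minkowski_bilin pp qq gpq gqp pN// qN//.
    rewrite [in RHS](fE _ wN) [RHS]addrAC; congr (_ + _).
      by congr (_ *: _ + _ *: _); ring.
    apply: eq_bigr => i _; rewrite !minkowski_bilin !(minkowskiC (f i)) pN// qN//.
    by congr (_ *: _); rewrite minkowskiC; ring.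
  have IC u v : g (I u) v = g u (I v).
    rewrite /I !minkowski_bilin minkowski_suml minkowski_sumr !(minkowskiC u).
    congr (_ + _); first by ring.
    by apply: eq_bigr => i _; rewrite minkowskiZl minkowskiZr (minkowskiC u); ring.
  have XI v : X *m I v = X *m v.
    apply/eqP; rewrite eq_sym -subr_eq0 -mulmxBr X0//.
    by apply/mem_perp => z zW; rewrite minkowskiBl IC II// subrr.
  have -> : X = 2^-1 *: (wedge q (X *m p) + wedge p (X *m q) +
      \sum_i wedge (f i) (X *m f i)).
    apply: mulmx_ext => v; rewrite -scalemxAl [in RHS]mulmxDl.
    rewrite [X in _ *: (X + _)]mulmxDl mulmx_suml !wedgeE.
    have -> : \sum_i wedge (f i) (X *m f i) *m v =
        \sum_i g (f i) v *: (X *m f i) + \sum_i g (f i) (X *m v) *: f i.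
      rewrite -big_split /=; apply: eq_bigr => i _.
      by rewrite wedgeE sX scaleNr opprK.
    rewrite !sX !scaleNr !opprK.
    have XvE : X *m v = I (X *m v) by rewrite II.
    have XvE' : X *m v = g q v *: (X *m p) + g p v *: (X *m q) +
        \sum_i g (f i) v *: (X *m f i).
      rewrite -{1}XI /I !mulmxDr -!scalemxAr mulmx_sumr.
      by congr (_ + _); apply: eq_bigr => i _; rewrite -scalemxAr.
    transitivity (2^-1 *: (X *m v + X *m v)).
      by rewrite -mulr2n -(scaler_nat 2 (X *m v)) scalerA mulVf ?scale1r// pnatr_eq0.
    congr (_ *: _); rewrite {1}XvE' {1}XvE /I.
    move: (\sum_i _) (\sum_i _) (X *m p) (X *m q) (g p (X *m v)) (g q (X *m v)).
    by move=> ? ? ? ? ? ?; apply/colP => i; rewrite !mxE; ring.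
  rewrite memvZ// memvD//; last first.
    by rewrite memv_suml// => i _; rewrite wedgeW// NW.
  by rewrite memvD// wedgeW.
have hW X : X \in h -> {in W, forall u, X *m u \in W}.
  move=> Xh; have sX := sh _ Xh.
  have XqW : X *m q \in W.
    apply: WI; rewrite skewadjvv// scale0r subr0 memN (graded_component pq)// andbT.
    rewrite mem_eucl !minkowskiBr !minkowskiZr gpq mulr1 subrr eqxx.
    by rewrite qq mulr0 subr0 skewadjvv// eqxx.
  have XpW : X *m p \in W.
    apply: WI; rewrite addrAC (skewadjvv p sX) scale0r subr0; apply: QN.
      rewrite mem_eucl !minkowskiBr !minkowskiZr pp mulr0 subr0 skewadjvv// eqxx.
      by rewrite gqp mulr1 subrr eqxx.
    exact: (graded_component qp).
  move=> _ /WP[a [b [w [wN ->]]]].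
  rewrite !mulmxDr -!scalemxAr memvD ?memvZ// memvD ?memvZ//.
  have pXw : wedge p (X *m w) \in h.
    have := lh _ _ Xh (NP _ wN); rewrite bracket_wedge// => H.
    by move: (memvB H (wedgeW _ _ XpW (NW _ wN))); rewrite addrAC subrr add0r.
  apply: WI; rewrite memN; apply/andP; split.
    rewrite mem_eucl !minkowski_bilin pp qq gpq gqp.
    by apply/andP; split; apply/eqP; ring.
  by rewrite !wedgeBr !wedgeZr wedgevv scaler0 subr0 memvB// memvZ.
exists N; split; first exact: capvSl.
rewrite -/W; split.
- exists t => //; split=> // w _; exact: timelike_perp.
- have -> : 3%N = \dim (<[p]> + <[w1]> + <[q]>)%VS.
    rewrite dimv_disjoint_sum; last first.
      apply/eqP; rewrite -subv0; apply/subvP => x; rewrite memv_cap memv0.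
      move=> /andP[/memv_addP[_ /vlineP[a ->] [_ /vlineP[b ->] ->]] /vlineP[c E]].
      have := congr1 (g p) E; rewrite !minkowski_bilin pp gpq pN// !mulr0 addr0 mulr1.
      by rewrite E => <-; rewrite scale0r.
    rewrite dimv_disjoint_sum; last first.
      apply/eqP; rewrite -subv0; apply/subvP => x; rewrite memv_cap memv0.
      move=> /andP[/vlineP[a ->] /vlineP[b E]].
      have := congr1 (g q) E; rewrite !minkowski_bilin gqp qN// mulr0 mulr1.
      by move=> ->; rewrite scale0r.
    by rewrite !dim_vline w1n0 (null_pair_neq0 pq) (null_pair_neq0 qp).
  by apply: dimvS; apply: addvS => //; apply: addvS => //; rewrite -memvE.
pose k := (h :&: so (perp W))%VS.
have kP X : X \in k -> [/\ X \in h, skewadj X & {in W, forall w, X *m w = 0}].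
  rewrite memv_cap => /andP[Xh /mem_soP[_ X0]]; split=> //; first exact: sh.
  move=> w wW; apply: X0; apply/mem_perp => z /mem_perp zW.
  by rewrite minkowskiC zW.
have kI X : X \in h -> {in W, forall w, X *m w = 0} -> X \in k.
  move=> Xh X0; rewrite memv_cap Xh; apply: mem_so_perp => //; first exact: sh.
  by move=> w; apply: (perpK tW tt).
exists k; split.
- split; first exact: capvSr.
  move=> X Y /kP[Xh _ X0] /kP[Yh _ Y0]; apply: kI; first exact: lh.
  by move=> w wW; rewrite bracketE (X0 w wW) (Y0 w wW) !mulmx0 subr0.
- by apply: (compact_lie_elliptic tt) => X /kP[_ sX X0] => //; exact: X0.
- apply/vspaceP => X; apply/idP/memv_addP => [Xh|[Y /soWh Yh [Z /kP[Zh _ _] ->]]].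
    have sX := sh _ Xh.
    have XPs : X *m P \in so W.
      apply/mem_soP; split=> [u v|w wW].
        by rewrite (skewadj_proj tW tt PW Pperp sX (hW _ Xh)) addNr.
      by rewrite -mulmxA (proj_perp tW tt PW Pperp wW) mulmx0.
    exists (X *m P) => //; exists (X - X *m P); last by rewrite addrC subrK.
    apply: kI; first by rewrite memvB// soWh.
    by move=> w wW; rewrite mulmxBl -mulmxA (proj_id tW tt PW Pperp wW) subrr.
  by rewrite memvD.
Qed.


(** * Classification *)
Lemma eigenvector_null X v c : skewadj X -> X *m v = c *: v -> c != 0 -> g v v = 0.
Proof.
move=> sX Xv c0; have := skewadjvv v sX; rewrite Xv minkowskiZr => /eqP.
by rewrite mulf_eq0 (negbTE c0) => /eqP.
Qed.

(** The image of [X + c] is orthogonal to [v], so that [X + c] is singular. *)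
Lemma eigenvalue_opp X v c : skewadj X -> v != 0 -> X *m v = c *: v ->
  exists2 w : V, w != 0 & X *m w = - c *: w.
Proof.
move=> sX vn0 Xv; pose Z := X + c%:M.
have ZE u : Z *m u = X *m u + c *: u by rewrite mulmxDl mul_scalar_mx.
have ZZ u : g v (Z *m u) = 0.
  by rewrite ZE minkowskiDr minkowskiZr -[g v (X *m u)]opprK -sX Xv minkowskiZl addNr.
have : \det Z^T == 0.
  rewrite det_tr; apply: contraTT vn0 => detZ; rewrite negbK; apply/eqP.
  have uZ : Z \in unitmx by rewrite unitmxE unitfE.
  by apply: minkowski_nondeg => u; rewrite -(ZZ (invmx Z *m u)) mulmxA mulmxV// mul1mx.
move/det0P => [r rn0 rZ]; exists r^T.
  by apply: contraNneq rn0 => r0; rewrite -[r]trmxK r0 trmx0.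
have : Z *m r^T = 0 by rewrite -[Z]trmxK -trmx_mul rZ trmx0.
by rewrite ZE => /eqP; rewrite addr_eq0 => /eqP ->; rewrite scaleNr.
Qed.

(** The invariant line transversal to the one of [q] consists of eigenvectors of
[d] for the eigenvalue [c]; all of those are null, so it is the line of [p]. *)
Lemma opposite_line p q h d c : null_pair p q -> {in h, forall X, skewadj X} ->
    null_reducible h -> d \in h -> c != 0 -> d *m p = c *: p -> d *m q = - c *: q ->
    (forall X, X \in h -> exists c, X *m q = c *: q) ->
  forall X, X \in h -> exists c, X *m p = c *: p.
Proof.
move=> pq sh redh dh c0 dp dq hq.
have [pp qq gpq] := pq; have gqp : g q p = 1 by rewrite minkowskiC.
have qn0 : q != 0 by apply: (@null_pair_neq0 q p).
have [u qu hu] := redh q qn0 qq hq.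
have [c' du] := hu _ dh; have sd := sh _ dh.
have cc : c' = c.
  by have := sd q u; rewrite dq du minkowskiZl minkowskiZr qu; lra.
rewrite cc in du.
have uu := eigenvector_null sd du c0.
have dpu : d *m (p - u) = c *: (p - u) by rewrite mulmxBr dp du scalerBr.
have := eigenvector_null sd dpu c0; rewrite !minkowski_bilin pp uu (minkowskiC u p) => pu.
have [|b uE] := null_perpP (null_pair_neq0 pq) pp _ uu; first by move: pu; lra.
(* Both are normalized by their product with [q]. *)
have b1 : b = 1 by move: qu; rewrite uE minkowskiZr gqp mulr1.
by rewrite uE b1 scale1r in hu.
Qed.

Lemma line_of_weights p q h : null_pair p q -> {in h, forall X, skewadj X} ->
    {in h, forall X, bracket (wedge p q) X \in h} ->
    (forall w, w \in eucl p q -> wedge p w \in h -> w = 0) ->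
  forall X, X \in h -> exists c, X *m q = c *: q.
Proof.
move=> pq sh gh w0 X Xh; have [pp qq gpq] := pq; exists (g p (X *m q)).
apply/eqP; rewrite -subr_eq0; apply/eqP; apply: w0; last exact: graded_component.
rewrite mem_eucl !minkowskiBr !minkowskiZr gpq qq mulr1 mulr0 subrr subr0.
by rewrite (skewadjvv q (sh _ Xh)) !eqxx.
Qed.

Lemma hyperbolic_type p q h d : null_pair p q -> {in h, forall X, skewadj X} ->
    bracket_closed h -> null_reducible h -> d \in h -> d *m p = - p -> d *m q = q ->
  typeII p q h \/ typeIII p q h.
Proof.
move=> pq sh lh redh dh dp dq; have gh := boost_stable pq sh lh dh dp dq.
have [pp qq gpq] := pq; have gqp : g q p = 1 by rewrite minkowskiC.
have qp : null_pair q p by [].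
have gh' : {in h, forall X, bracket (wedge q p) X \in h}.
  move=> X Xh; rewrite bracketC (wedgeC q p) bracketNr opprK -[bracket _ _]opprK.
  by rewrite -bracketC memvN gh.
have dpE : d *m p = -1 *: p by rewrite scaleN1r.
have dqE : d *m q = - (-1) *: q by rewrite opprK scale1r.
have dpE' : d *m p = - 1 *: p by rewrite scaleN1r.
have dqE' : d *m q = 1 *: q by rewrite scale1r.
have n1 : -1 != 0 :> R by rewrite oppr_eq0 oner_eq0.
have weightP (a b : V) : (exists w, [/\ w \in eucl a b, w != 0 & wedge a w \in h]) \/
    (forall w, w \in eucl a b -> wedge a w \in h -> w = 0).
  have [H|H] := pselect (exists w, [/\ w \in eucl a b, w != 0 & wedge a w \in h]).
    by left.
  by right => w wE wh; apply/eqP; apply: contraT => wn0; case: H; exists w.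
have [[w1 [w1E w1n0 w1h]]|w0] := weightP p q; last first.
  have hq := line_of_weights pq sh gh w0.
  have hp := opposite_line pq sh redh dh n1 dpE dqE hq.
  by right; exact: (typeIII_of_lines pq sh lh dh dp dq).
have [[w2 [w2E w2n0 w2h]]|w0] := weightP q p; last first.
  have hp := line_of_weights qp sh gh' w0.
  have hq := opposite_line qp sh redh dh (oner_neq0 R) dqE' dpE' hp.
  by right; exact: (typeIII_of_lines pq sh lh dh dp dq).
left; apply: (typeII_of_weights pq sh lh gh w1E w1n0 w1h _ w2n0 w2h).
by rewrite /eucl addvC.
Qed.

Lemma elliptic_typeI t h : g t t < 0 -> {in h, forall X, skewadj X} ->
  bracket_closed h ->
  {in h, forall X, X *m t = 0} -> exists T, lorentz_group T /\ typeI (conj_lie T h).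
Proof.
move=> tt sh lh ht; pose c := Num.sqrt (- g t t).
have c2 : c ^+ 2 = - g t t by rewrite sqr_sqrtr// oppr_ge0 ltW.
have [||T [iT Tt]] := @lorentz_map t (c *: e0).
- by rewrite !minkowski_bilin minkowski_e0e0; lra.
- by rewrite lt_eqF.
have c0 : c != 0 by rewrite -sqrf_eq0 c2 oppr_eq0 lt_eqF.
have Ke0 : invmx T *m e0 = c^-1 *: t.
  by rewrite -[t](lorentzK _ iT) Tt -scalemxAr scalerA mulVf// scale1r.
exists T; split=> //; split; last by apply: conj_bracket_closed => //; exact: lorentz_unit.
apply/subvP => X Xh; apply: mem_so_perp; first exact: (conj_skewadj iT sh).
  move=> _ /vlineP[a ->]; have /mem_conj_lie[Y Yh ->] := Xh.
  by rewrite -scalemxAr -!mulmxA Ke0 -scalemxAr ht// scaler0 mulmx0 scaler0.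
by move=> w; apply: (perpK (memv_line e0)); rewrite minkowski_e0e0 ltrN10.
Qed.
End Minkowski.

Theorem theorem2p4 (R : realType) (n : nat)
    (p : 'cV[R]_n.+2) (e : n.-tuple 'cV[R]_n.+2) (q : 'cV[R]_n.+2)
    (h : {vspace 'M[R]_n.+2}) :
  witt_basis p e q ->
  lie_subalgebra (so fullv) h ->
  totally_reducible h ->
  exists T : 'M[R]_n.+2, lorentz_group T /\
    [\/ typeI (conj_lie T h), typeII p q (conj_lie T h)
      | typeIII p q (conj_lie T h)].
Proof.
move=> [pq _ _ _] [/subvP hso lh] trh.
have sh : {in h, forall X, skewadj X} by move=> X /hso /mem_so_full.
have redh := totally_reducible_null sh trh.
have [nh|/existsNP[X /not_implyP[Xh nX]]] := pselect (forall X, X \in h -> nonhyperbolic X).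
  have [t tt ht] := fixes_timelike sh lh nh redh.
  have [T [iT hT]] := elliptic_typeI tt sh lh ht.
  by exists T; split=> //; apply: Or31.
have [v [c [vn0 Xv c0]]] :
    exists (v : 'cV[R]_n.+2) c, [/\ v != 0, X *m v = c *: v & c != 0].
  apply: contrapT => H; apply: nX => v c vn0 Xv; apply/eqP; apply: contraT => c0.
  by case: H; exists v, c.
pose d := - c^-1 *: X; have dh : d \in h by rewrite memvZ.
have sd := sh _ dh.
have dv : d *m v = -1 *: v by rewrite -scalemxAl Xv scalerA mulNr mulVf.
have n1 : -1 != 0 :> R by rewrite oppr_eq0 oner_eq0.
have [w wn0 dw] := eigenvalue_opp sd vn0 dv.
rewrite opprK in dw.
have vv := eigenvector_null sd dv n1.
have ww := eigenvector_null sd dw (oner_neq0 R).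
have vw : minkowski v w != 0.
  apply/eqP => vw; have [b wE] := null_perpP vn0 vv vw ww.
  have : d *m w = -1 *: w by rewrite wE -scalemxAr dv scalerA mulrC -scalerA.
  rewrite dw => /eqP; rewrite -subr_eq0 -scalerBl scaler_eq0 (negbTE wn0) orbF.
  by rewrite opprK -mulr2n pnatr_eq0.
pose w' := (minkowski v w)^-1 *: w.
have vw' : null_pair v w'.
  by split=> //; rewrite /w' !minkowski_bilin ?ww ?mulr0// mulVf.
have dw' : d *m w' = w' by rewrite -scalemxAr dw scale1r.
have [T [iT Tv Tw]] := lorentz_map_null_pair vw' pq.
exists T; split=> //.
have uT := lorentz_unit iT.
have d1h : T *m d *m invmx T \in conj_lie T h by apply/mem_conj_lie; exists d.
have [] := hyperbolic_type pq (conj_skewadj iT sh) (conj_bracket_closed uT lh)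
  (conj_null_reducible iT redh) d1h.
- by rewrite -!mulmxA -Tv lorentzK// dv scaleN1r mulmxN.
- by rewrite -!mulmxA -Tw lorentzK// dw'.
- by apply: Or32.
- by apply: Or33.
Qed.
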